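(* Let $d\in\mathbb N$ and let $\Phi_d\in(\mathcal M^{2d})'$ be the Hida distribution with $T$-transform $T\Phi_d(F,G)=\exp\left(-i\sum_{\mu=1}^dTr(F_\mu G_\mu)\right)$, $(F,G)\in\mathcal M^{2d}$. For $1\le\mu,\nu\le d$ and $k,l,m,n\in\mathbb N$ define the propagators $$\langle A_\mu^{kl}B_\nu^{mn}\rangle:=\langle\!\langle\Phi_d,A_\mu^{kl}B_\nu^{mn}\rangle\!\rangle,\quad\langle A_\mu^{kl}A_\nu^{mn}\rangle:=\langle\!\langle\Phi_d,A_\mu^{kl}A_\nu^{mn}\rangle\!\rangle,\quad\langle B_\mu^{kl}B_\nu^{mn}\rangle:=\langle\!\langle\Phi_d,B_\mu^{kl}B_\nu^{mn}\rangle\!\rangle,$$ where $A_\mu^{kl}$ and $B_\mu^{kl}$ denote the matrix-coefficient functions $(A,B)\mapsto A_\mu^{kl}$ and $(A,B)\mapsto B_\mu^{kl}$ on ${\mathcal M'}^{2d}$. Then $$\langle A_\mu^{kl}B_\nu^{mn}\rangle=i\,\delta_{\mu\nu}\,\delta^{kn}\,\delta^{lm},\qquad\langle A_\mu^{kl}A_\nu^{mn}\rangle=\langle B_\mu^{kl}B_\nu^{mn}\rangle=0,$$ where $\delta_{\mu\nu}$, $\delta^{kn}$, $\delta^{lm}$ are Kronecker deltas.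
   Context: Matrix spaces. $\mathcal T$ is the real Hilbert space of Hermitian Hilbert–Schmidt operators on an infinite-dimensional separable complex Hilbert space, represented via a fixed orthonormal basis as infinite Hermitian matrices $(a_{ij})_{i,j\in\mathbb N}$, with inner product $(A,B)=Tr(BA)$. $\mathcal M\subset\mathcal T$ is the subspace of matrices with only finitely many nonzero entries, with the nuclear topology given as the projective limit of the weighted Hilbert spaces $\mathcal T_p$ with norms $|F|_p^2=\sum_{i,j}p_{ij}|F_{ij}|^2$, over all symmetric weights $p=(p_{ij})$ with $p_{ij}\ge1$. Its dual $\mathcal M'$ is the space of all infinite Hermitian matrices, with pairing $\langle A,F\rangle=\sum_{i,j}A_{ij}F_{ji}$ extending $(\cdot,\cdot)$. $\mathcal M^{2d}\subset\mathcal T^{2d}\subset{\mathcal M'}^{2d}$ are the $2d$-fold products, with pairing and inner product summed over components; elements of ${\mathcal M'}^{2d}$ are written $(A,B)$ with $A=(A_\mu)_{\mu=1}^d$, $B=(B_\mu)_{\mu=1}^d$, and $A_\mu^{kl}$ is the $(k,l)$ entry of the Hermitian matrix $A_\mu$. The real and imaginary parts of $A_\mu^{kl}$, $B_\mu^{kl}$ are of the form $\langle\cdot,F\rangle$ with $F\in\mathcal M^{2d}$. $\mu_d$ is the standard Gaussian measure on ${\mathcal M'}^{2d}$, with characteristic function $\int\exp(i\langle A,F\rangle)\,d\mu_d(A)=\exp(-\frac12|F|^2)$, $F\in\mathcal M^{2d}$. Hida triple $(\mathcal M^{2d})\subset L^2(\mu_d)\subset(\mathcal M^{2d})'$ (complex-valued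 functions). Wick monomials are defined by $\exp(\langle A,F\rangle-\frac12|F|^2)=\sum_{n\ge0}\frac1{n!}\langle:A^{\otimes n}:,F^{\otimes n}\rangle$, and each $f\in L^2(\mu_d)$ has a unique chaos decomposition $f=\sum_n\langle:A^{\otimes n}:,f^{(n)}\rangle$ with $f^{(n)}$ in the symmetric tensor power $(\mathcal T^{2d}_{\mathbb C})^{\hat\otimes n}$. The space of test functions $(\mathcal M^{2d})$ is the projective limit, over weights $p$ and $q\in\mathbb N$, of the Hilbert spaces given by the norms $\|\varphi\|_{p,q}^2=\sum_nn!\,2^{nq}|\varphi^{(n)}|_p^2$; it contains all complex polynomials in the functions $\langle\cdot,F\rangle$, $F\in\mathcal M^{2d}$. Its topological dual $(\mathcal M^{2d})'$ is the space of Hida distributions, with (complex) bilinear dual pairing $\langle\!\langle\cdot,\cdot\rangle\!\rangle$ extending $\langle\!\langle f,\varphi\rangle\!\rangle=\int f\varphi\,d\mu_d$. The $T$-transform of $\Phi\in(\mathcal M^{2d})'$ is $T\Phi(F)=\langle\!\langle\Phi,\exp(i\langle\cdot,F\rangle)\rangle\!\rangle$, $F\in\mathcal M^{2d}$; it determines $\Phi$ uniquely, and a Hida distribution $\Phi_d$ with the $T$-transform in the claim exists. *)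

(* Defs.v *)
From HB Require Import structures.
From mathcomp Require Import all_boot all_order all_algebra.
From mathcomp Require Import complex.
From mathcomp Require Import all_classical all_reals all_analysis.
Import Order.TTheory GRing.Theory Num.Theory ComplexField Normc.
Import numFieldNormedType.Exports.

Set Implicit Arguments.
Unset Strict Implicit.
Unset Printing Implicit Defensive.

Local Open Scope classical_set_scope.
Local Open Scope ring_scope.
Local Open Scope complex_scope.

Section Matrices.
Variable R : realType.

(* The dualM space M': all infinite Hermitian matrices. *)
Record hmatrix := HMatrix {
  hmatrix_fun :> nat -> nat -> R[i];
  hmatrixP : forall k l, hmatrix_fun l k = (hmatrix_fun k l)^* }.

(* The space M: Hermitian matrices with finitely many nonzero entries. *)
Record finhmatrix := FinHMatrix {
  finhmatrix_val :> hmatrix;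
  finhmatrixP : finite_set [set kl | finhmatrix_val kl.1 kl.2 != 0] }.

Fact hmatrix0_subproof (k l : nat) : (0 : R[i]) = 0^*.
Proof. by rewrite conjc0. Qed.

Definition hmatrix0 := HMatrix (hmatrix_fun := fun _ _ => 0) hmatrix0_subproof.

HB.instance Definition _ := gen_eqMixin hmatrix.
HB.instance Definition _ := gen_choiceMixin hmatrix.
HB.instance Definition _ := isPointed.Build hmatrix hmatrix0.

(* [\sum_(i \in [set: _])] is the sum over the support when that is finite and
   0 otherwise.  Below some factor always has finite support. *)

(* <A, F> = \sum_(i,j) A_ij F_ji *)
Definition mpair (A : hmatrix) (F : finhmatrix) : R[i] :=
  \sum_(kl \in [set: nat * nat]) A kl.1 kl.2 * F kl.2 kl.1.

Definition mprod (F G : nat -> nat -> R[i]) (i j : nat) : R[i] :=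
  \sum_(k \in [set: nat]) F i k * G k j.

Definition mtr (F : nat -> nat -> R[i]) : R[i] :=
  \sum_(k \in [set: nat]) F k k.

(* |F|^2 = \sum_(i,j) |F_ij|^2 *)
Definition msqnorm (F : finhmatrix) : R :=
  \sum_(kl \in [set: nat * nat]) normc (F kl.1 kl.2) ^+ 2.

Definition cexp (z : R[i]) : R[i] :=
  (expR (complex.Re z))%:C * (cos (complex.Im z) +i* sin (complex.Im z)).

End Matrices.


Section HidaTriple.
Variables (R : realType) (d : nat).

Definition dualM := (('I_d -> hmatrix R) * ('I_d -> hmatrix R))%type.
Definition testM := (('I_d -> finhmatrix R) * ('I_d -> finhmatrix R))%type.

HB.instance Definition _ := Pointed.on dualM.

Definition testM_dual (F : testM) : dualM :=
  (fun mu => F.1 mu : hmatrix R, fun mu => F.2 mu : hmatrix R).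

Definition pairing (x : dualM) (F : testM) : R[i] :=
  \sum_(mu < d) (mpair (x.1 mu) (F.1 mu) + mpair (x.2 mu) (F.2 mu)).

Definition sqnorm (F : testM) : R :=
  \sum_(mu < d) (msqnorm (F.1 mu) + msqnorm (F.2 mu)).

(* M' carries the sigma-algebra generated by the functions <., F>.  It contains
   the Borel sets of the weak and strong topologies, as M has countable
   dimension. *)
Definition cylinders : set (set dualM) :=
  [set E | exists F (B : set R), measurable B /\
     E = [set x | B (complex.Re (pairing x F))]].

Definition dualMs := g_sigma_algebraType cylinders.

Definition cintegral (mu : probability dualMs R) (f : dualM -> R[i]) : R[i] :=
  (\int[mu]_x complex.Re (f x)) +i* (\int[mu]_x complex.Im (f x)).

Definition standard_gaussian (mu : probability dualMs R) :=
  forall F, cintegral mu (fun x => cexp ('i * pairing x F)) =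
            cexp (- (sqnorm F / 2)%:C).

(* Coordinates: [inl mu] indexes the components A_mu, [inr mu] the components
   B_mu.  The complexification of M^{2d} is the space of 2d-tuples of all
   finite complex matrices, so that n-tensors over it are arrays of complex
   numbers indexed by [n.-tuple idx]. *)
Definition idx := (('I_d + 'I_d) * (nat * nat))%type.

Definition entry (x : dualM) (i : idx) : R[i] :=
  match i.1 with
  | inl mu => x.1 mu i.2.1 i.2.2
  | inr mu => x.2 mu i.2.1 i.2.2
  end.

Definition flip (i : idx) : idx := (i.1, (i.2.2, i.2.1)).

Definition tensor (n : nat) := n.-tuple idx -> R[i].

Definition symmetric_tensor n (g : tensor n) :=
  forall t u : n.-tuple idx, perm_eq t u -> g t = g u.

Definition finite_tensor n (g : tensor n) :=
  finite_set [set t | g t != 0].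

Definition tpow (F : testM) n : tensor n :=
  fun t => \prod_(i <- t) entry (testM_dual F) i.
Arguments tpow F n t : clear implicits.

(* The bilinear extension to n-tensors of <A, F> = \sum_(i,j) A_ij F_ji *)
Definition tpair n (S g : tensor n) : R[i] :=
  \sum_(t \in [set: n.-tuple idx]) S t * g (map_tuple flip t).

(* [W x n] is the n-th Wick power :x^{(x) n}:, a symmetric tensor in the dual.
   The generating function determines it, because the tensor powers of
   elements of M^{2d} span the finite symmetric tensors. *)
Definition wick_monomials (W : dualM -> forall n, tensor n) :=
  (forall x n, symmetric_tensor (W x n)) /\
  (forall x F,
     (\sum_(0 <= n < N) (n`!%:R)^-1 * tpair (W x n) (tpow F n)) @[N --> \oo]
       --> (cexp (pairing x F - (sqnorm F / 2)%:C) : (R[i])^o)).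

Definition weight (p : nat -> nat -> R) :=
  (forall k l, p k l = p l k) /\ (forall k l, 1 <= p k l).

Definition tsqnorm (p : nat -> nat -> R) n (g : tensor n) : \bar R :=
  \esum_(t in [set: n.-tuple idx])
    ((\prod_(i <- t) p i.2.1 i.2.2) * normc (g t) ^+ 2)%:E.

Definition tsqnorm1 n (g : tensor n) : \bar R := tsqnorm (fun _ _ => 1) g.

(* Elements of L^2 are represented by functions, not by classes modulo
   almost everywhere equality. *)
Definition cL2 (mu : probability dualMs R) (f : dualM -> R[i]) :=
  [/\ measurable_fun [set: dualMs] (fun x : dualMs => complex.Re (f x)),
      measurable_fun [set: dualMs] (fun x : dualMs => complex.Im (f x)) &
      (\int[mu]_x (normc (f x) ^+ 2)%:E < +oo)%E].

Definition cL2_cvg (mu : probability dualMs R) (f_ : nat -> dualM -> R[i])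
    (f : dualM -> R[i]) :=
  (\int[mu]_x (normc (f_ N x - f x) ^+ 2)%:E)%E @[N --> \oo] --> 0%E.

(* [w] represents <:x^{(x) n}:, g> for a kernel [g] with possibly infinite
   support: the L^2-limit along finite symmetric tensors converging to [g]. *)
Definition wick_functional (mu : probability dualMs R)
    (W : dualM -> forall n, tensor n) n (g : tensor n) (w : dualM -> R[i]) :=
  cL2 mu w /\
  exists g_ : nat -> tensor n,
    [/\ forall N, symmetric_tensor (g_ N) /\ finite_tensor (g_ N),
        tsqnorm1 (fun t => g_ N t - g t) @[N --> \oo] --> 0%E &
        cL2_cvg mu (fun N x => tpair (W x n) (g_ N)) w].

Definition chaos (mu : probability dualMs R) (W : dualM -> forall n, tensor n)
    (f : dualM -> R[i]) (K : forall n, tensor n) :=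
  [/\ cL2 mu f,
      forall n, symmetric_tensor (K n) /\ (tsqnorm1 (K n) < +oo)%E &
      exists w : nat -> dualM -> R[i],
        (forall n, wick_functional mu W (K n) (w n)) /\
        cL2_cvg mu (fun N x => \sum_(0 <= n < N) w n x) f].

Definition kernel_sqnorm (p : nat -> nat -> R) (q : nat) (K : forall n, tensor n)
    : \bar R :=
  (\sum_(0 <= n <oo) (n`! * 2 ^ (n * q))%:R%:E * tsqnorm p (K n))%E.

(* Almost everywhere equal functions have the same kernels, and kernels are
   unique, so the infimum is over at most one kernel sequence; it is +oo if
   there is none. *)
Definition hida_sqnorm mu W p q (f : dualM -> R[i]) : \bar R :=
  ereal_inf [set kernel_sqnorm p q K | K in chaos mu W f].

Definition hida_test mu W (f : dualM -> R[i]) :=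
  forall p q, weight p -> (hida_sqnorm mu W p q f < +oo)%E.

(* Distributions are total functions of which only the values at test functions
   matter.  Linearity and continuity force equal values at almost everywhere
   equal test functions. *)
Definition hida_linear mu W (Phi : (dualM -> R[i]) -> R[i]) :=
  forall (a : R[i]) f g, hida_test mu W f -> hida_test mu W g ->
    Phi (fun x => a * f x + g x) = a * Phi f + Phi g.

(* Continuity for the projective limit topology.  One seminorm suffices in a
   basic neighbourhood since the family is directed: the seminorm for
   (max p p', max q q') dominates those for (p, q) and (p', q'). *)
Definition hida_continuous mu W (Phi : (dualM -> R[i]) -> R[i]) :=
  forall f, hida_test mu W f -> forall e : R, 0 < e ->
  exists p q (delta : R), [/\ weight p, 0 < delta &
    forall g, hida_test mu W g ->
      (hida_sqnorm mu W p q (fun x => (g x - f x)%R) < (delta ^+ 2)%:E)%E ->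
      normc (Phi g - Phi f) < e].

Definition hida_distribution mu W (Phi : (dualM -> R[i]) -> R[i]) :=
  hida_linear mu W Phi /\ hida_continuous mu W Phi.

Definition T_transform (Phi : (dualM -> R[i]) -> R[i]) (F : testM) : R[i] :=
  Phi (fun x => cexp ('i * pairing x F)).

Definition entryA (mu : 'I_d) (k l : nat) (x : dualM) : R[i] := x.1 mu k l.
Definition entryB (mu : 'I_d) (k l : nat) (x : dualM) : R[i] := x.2 mu k l.

Definition propagator (Phi : (dualM -> R[i]) -> R[i]) (f g : dualM -> R[i]) : R[i] :=
  Phi (fun x => f x * g x).

End HidaTriple.

(* Main.v *)
Require Import Defs.
From mathcomp Require Import all_boot all_order all_algebra.
From mathcomp Require Import complex finmap.
From mathcomp Require Import all_classical all_reals all_analysis.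
From mathcomp Require Import measurable_realfun.
From mathcomp Require Import ring lra zify.

(** Differentiating the [T]-transform twice yields the propagators.  Along a test
    element [F], the hypothesis says that [Phi] maps [exp (i t <., F>)] to
    [exp (- i t^2 tau(F, F))], where [tau(F, G)] is the sum over [mu] of
    [Tr (F_mu G_mu)], formed with the components [A] of [F] and [B] of [G]
    ([tform]).  If the second difference quotient at [t = 0] of
    [exp (i t <., F>)] converges to [- <., F>^2] in the space of test functions,
    then continuity and linearity of [Phi] give [Phi (<., F>^2) = 2 i tau(F, F)]
    ([Phi_square]), and by polarization
    [Phi (<., F> <., G>) = i (tau(F, G) + tau(G, F))] ([Phi_product]).  A matrix
    coefficient is [<., S> + i <., T>], where [S + i T] is a matrix unit;
    substituting matrix units into [tau] produces the Kronecker deltas, and [0]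
    when both coefficients belong to [A] or both to [B].

    The convergence of the difference quotient requires explicit chaos
    expansions.  The value of [<:x^n:, F^n>] is [n!] times the [n]-th Taylor
    coefficient in [s] of [exp (s <x, F> - s^2 |F|^2 / 2)], a Hermite polynomial
    in [<x, F>] ([wick_hermite]): the generating function is given for real
    multiples of [F], and uniqueness of power series identifies the coefficients
    ([power_series_eq0], [cauchy_product]).  The same Hermite series at imaginary
    [s] converges pointwise to [exp (i t <x, F>)].  In the expansion of the
    difference between the quotient and [<., F>^2], the coefficient of order [n]
    is [O(t^2) / n!] uniformly in [n] ([quotient_coef_le]), so that all weighted
    norms are [O(t^2)] ([hida_sqnorm_second_quotient]).

    Pointwise expansions become chaos expansions once the series also converges
    in [L^2].  The partial sums are dominated by a multiple of
    [exp (2 r |<x, F>|)], so dominated convergence applies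
    ([finite_chaos_series]), provided that the measure has exponential moments.
    Only its characteristic function is given.  It is the limit of the
    characteristic functions of random walks with fair steps, so expectations of
    trigonometric polynomials are limits of expectations for walks, which are
    finite averages; trigonometric polynomials that approximate [exp (c y)] from
    within [exp |c y|] then transfer the exponential moments of walks to the
    Gaussian measure ([gaussian_expR_moment]). *)

Import Order.TTheory GRing.Theory Num.Theory ComplexField Normc.
Import numFieldNormedType.Exports.
Set Implicit Arguments.
Unset Strict Implicit.
Unset Printing Implicit Defensive.
Local Open Scope classical_set_scope.
Local Open Scope ring_scope.
Local Open Scope complex_scope.

(** * Taylor bounds and two exponential limits *)

Section ElementaryBounds.
Variable R : realType.
Implicit Types x y w K : R.

Lemma mvt_bound (f df : R -> R) x K :
  (forall y, is_derive y 1 f (df y)) ->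
  (forall y, `|y| <= `|x| -> `|df y| <= K) -> `|f x - f 0| <= K * `|x|.
Proof.
move=> fdf dfK.
have cf : continuous f.
  by move=> y; apply/differentiable_continuous/derivable1_diffP; by case: (fdf y).
have [x0|x0] := leP 0 x.
  have [|c + ->] := MVT_segment x0 (fun y _ => fdf y).
    exact: continuous_subspaceT.
  rewrite in_itv/= => /andP[c0 cx]; rewrite subr0 normrM ler_wpM2r// dfK//.
  by rewrite !ger0_norm.
have [|c + fx] := MVT_segment (ltW x0) (fun y _ => fdf y).
  exact: continuous_subspaceT.
rewrite in_itv/= => /andP[xc c0]; rewrite distrC fx sub0r normrM normrN.
by rewrite ler_wpM2r// dfK// !ler0_norm ?lerN2// ltW.
Qed.

Lemma sin_bound x : `|sin x| <= `|x|.
Proof.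
have := @mvt_bound sin cos x 1 (fun y => is_derive_sin y).
by rewrite sin0 subr0 mul1r; apply=> y _; exact: cos_max.
Qed.

Lemma cos_bound x : `|cos x - 1| <= x ^+ 2.
Proof.
have := @mvt_bound cos (fun y => - sin y) x `|x| (fun y => is_derive_cos y).
rewrite cos0 -normrM -expr2 ger0_norm ?sqr_ge0//; apply=> y yx.
by rewrite normrN (le_trans (sin_bound y)).
Qed.

Lemma sin_bound3 x : `|sin x - x| <= `|x| ^+ 3.
Proof.
have := @mvt_bound (fun y => sin y - y) (fun y => cos y - 1) x (x ^+ 2).
rewrite sin0 !subr0 -real_normK ?num_real// -exprSr; apply.
move=> y yx; rewrite (le_trans (cos_bound y))// -real_normK ?num_real//.
by rewrite ler_pXn2r ?nnegrE.
Qed.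

Lemma cos_bound4 x : `|cos x - 1 + x ^+ 2 / 2| <= x ^+ 4.
Proof.
have := @mvt_bound (fun y => cos y - 1 + y ^+ 2 / 2) (fun y => - (sin y - y)) x (`|x| ^+ 3).
rewrite cos0 expr0n/= mul0r subrr addr0 subr0 -exprSr.
have -> : `|x| ^+ 4 = x ^+ 4 by rewrite (exprM _ 2 2) real_normK ?num_real// -exprM.
apply; last first.
  move=> y yx; rewrite normrN (le_trans (sin_bound3 y))//.
  by rewrite ler_pXn2r ?nnegrE.
move=> y; have := is_deriveD (is_deriveB (is_derive_cos y) (is_derive_cst (1:R) y 1))
  (is_deriveM (is_deriveX 2 (is_derive_id y (1:R))) (is_derive_cst (2^-1:R) y 1)).
move=> H; apply: (is_derive_eq H); rewrite /GRing.scale/= expr1; by field.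
Qed.

(** The Taylor remainder of order two, from [1 - w <= exp (- w)] alone. *)
Lemma expR_bound2 w : `|expR w - 1 - w| <= w ^+ 2 * expR `|w|.
Proof.
have lb := expR_ge1Dx w.
have e0 := expR_gt0 w.
have ub : expR w * (1 - w) <= 1.
  by rewrite -[leRHS](expRxMexpNx_1 w) ler_wpM2l ?expR_ge0 ?expR_ge1Dx.
rewrite ger0_norm; last by rewrite subr_ge0 lerBrDl.
have [w0|w0] := leP 0 w; first by rewrite ger0_norm//; nra.
have e1 : 1 <= expR (- w) by rewrite -(expR0 R) ler_expR; lra.
by rewrite ltr0_norm//; nra.
Qed.

(** Telescoping.  When [x - y] is [o(1 / m)] and [K ^+ m] stays bounded, the two
    powers have the same limit. *)
Lemma exprB_bound x y K m : `|x| <= K -> `|y| <= K -> 1 <= K ->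
  `|x ^+ m - y ^+ m| <= m%:R * `|x - y| * K ^+ m.
Proof.
move=> xK yK K1; have K0 : 0 <= K by apply: le_trans K1.
elim: m => [|m IH]; first by rewrite !expr0 subrr normr0 !mul0r.
have -> : x ^+ m.+1 - y ^+ m.+1 = x * (x ^+ m - y ^+ m) + (x - y) * y ^+ m.
  by rewrite !exprS; ring.
rewrite (le_trans (ler_normD _ _))// !normrM.
have -> : m.+1%:R * `|x - y| * K ^+ m.+1 =
   K * (m%:R * `|x - y| * K ^+ m) + `|x - y| * K ^+ m.+1.
  by rewrite -natr1 exprS; ring.
apply: lerD; first by apply: ler_pM.
rewrite ler_wpM2l// normrX (@le_trans _ _ (K ^+ m))//; first exact: lerXn2r.
by rewrite exprS ler_peMl// exprn_ge0.
Qed.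

End ElementaryBounds.

Section GaussianLimits.
Variable R : realType.
Implicit Types s v c y : R.

Lemma cvg_const_over_succ (C : R) : C / m.+1%:R @[m --> \oo] --> 0.
Proof.
by rewrite -[X in _ --> X](mulr0 C); apply: cvgMr; exact: cvg_harmonic.
Qed.

(** The central limit theorem for characteristic functions: [cos (s u) ^+ m] is
    the characteristic function at [s] of a walk of [m] fair steps of size [u],
    and [m * u ^+ 2 = v] here.  One step differs from its Gaussian counterpart by
    [O(m^-2)]. *)
Lemma cvg_cos_pow s v : 0 <= v ->
  cos (s * Num.sqrt (v / m.+1%:R)) ^+ m.+1 @[m --> \oo] --> expR (- (s ^+ 2 * v / 2)).
Proof.
move=> v0; set A := s ^+ 2 * v; have A0 : 0 <= A by rewrite mulr_ge0// sqr_ge0.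
apply/cvgrPdist_le => /= e e0.
have /cvgrPdist_le/(_ _ e0) := cvg_const_over_succ (A ^+ 2 * (1 + expR A)).
apply: filterS => m; rewrite sub0r normrN => /(le_trans (ler_norm _)); apply: le_trans.
set k : R := m.+1%:R; have k0 : 0 < k by rewrite ltr0n.
have k1 : 1 <= k by rewrite ler1n.
set y := s * _.
have y2 : y ^+ 2 = A / k.
  by rewrite exprMn sqr_sqrtr ?mulrA// divr_ge0// ltW.
have -> : expR (- (A / 2)) = expR (- (y ^+ 2 / 2)) ^+ m.+1.
  rewrite -expRM_natl -/k y2; congr expR; field; exact: lt0r_neq0.
rewrite distrC (le_trans (@exprB_bound _ _ _ 1 _ (cos_max _) _ _))//.
  by rewrite ger0_norm ?expR_ge0// -[leRHS]expR0 ler_expR oppr_le0 divr_ge0 ?sqr_ge0.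
rewrite expr1n mulr1 -/k.
have b1 := cos_bound4 y; have b2 := expR_bound2 (- (y ^+ 2 / 2)).
have Ak : A / k <= A by rewrite ler_pdivrMr// ler_peMr.
have Ak0 : 0 <= A / k by rewrite divr_ge0 // ltW.
have y4 : y ^+ 4 = (A / k) ^+ 2 by rewrite (exprM _ 2 2) y2.
have d : `|cos y - expR (- (y ^+ 2 / 2))| <= (A / k) ^+ 2 * (1 + expR A).
  have e1 : expR `|- (y ^+ 2 / 2)| <= expR A.
    by rewrite ler_expR normrN ger0_norm ?divr_ge0 ?sqr_ge0// y2; clear -Ak Ak0; clearbody k A; lra.
  have e2 : (- (y ^+ 2 / 2)) ^+ 2 * expR `|- (y ^+ 2 / 2)| <= (A / k) ^+ 2 * expR A.
    apply: ler_pM; rewrite ?sqr_ge0 ?expR_ge0// sqrrN y2.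
    by rewrite ler_pXn2r ?nnegrE//; clear -Ak Ak0; clearbody k A; lra.
  have -> : cos y - expR (- (y ^+ 2 / 2)) =
    (cos y - 1 + y ^+ 2 / 2) - (expR (- (y ^+ 2 / 2)) - 1 - - (y ^+ 2 / 2)) by ring.
  rewrite (le_trans (ler_normB _ _))// mulrDr mulr1 -y4 lerD//.
  by rewrite y4 (le_trans b2).
apply: (@le_trans _ _ (k * ((A / k) ^+ 2 * (1 + expR A)))).
  by rewrite ler_wpM2l// ltW.
rewrite le_eqVlt; apply/orP; left; apply/eqP; field; exact: lt0r_neq0.
Qed.

(** A substitute for [(1 + c y / M)^M] by trigonometric polynomials in [y]. *)
Lemma cvg_sin_pow c y :
  (1 + c * sin (y / m.+1%:R)) ^+ m.+1 @[m --> \oo] --> expR (c * y).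
Proof.
set L := expR `|c * y|; set B := L * (`|c| * `|y| ^+ 3 + (c * y) ^+ 2 * L).
apply/cvgrPdist_le => /= e e0.
have /cvgrPdist_le/(_ _ e0) := cvg_const_over_succ B.
apply: filterS => m; rewrite sub0r normrN => /(le_trans (ler_norm _)); apply: le_trans.
set k : R := m.+1%:R; have k0 : 0 < k by rewrite ltr0n.
have k1 : 1 <= k by rewrite ler1n.
set u := y / k.
have ek : expR (c * y) = expR (c * u) ^+ m.+1.
  rewrite -expRM_natl -/k; congr expR; rewrite /u; field; exact: lt0r_neq0.
have Lk : L = expR `|c * u| ^+ m.+1.
  rewrite -expRM_natl -/k; congr expR.
  have -> : `|c * u| = `|c * y| / k by rewrite /u mulrA normrM [X in _ * X]gtr0_norm ?invr_gt0.
  by field; exact: lt0r_neq0.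
rewrite distrC ek.
have K1 : 1 <= expR `|c * u| by rewrite -expR0 ler_expR.
have csu : `|c * sin u| <= `|c * u| by rewrite !(normrM c) ler_wpM2l// sin_bound.
apply: (le_trans (@exprB_bound _ _ _ (expR `|c * u|) _ _ _ _)) => //.
- rewrite (le_trans (ler_normD _ _))// normr1 (le_trans _ (expR_ge1Dx _))//.
  by rewrite lerD2l.
- by rewrite ger0_norm ?expR_ge0// ler_expR ler_norm.
rewrite -Lk -/k.
have d : `|1 + c * sin u - expR (c * u)| <= `|c| * `|u| ^+ 3 + (c * u) ^+ 2 * L.
  have -> : 1 + c * sin u - expR (c * u) = c * (sin u - u) - (expR (c * u) - 1 - c * u).
    ring.
  rewrite (le_trans (ler_normB _ _))// lerD//.
    by rewrite (normrM c) ler_wpM2l// sin_bound3.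
  rewrite (le_trans (expR_bound2 _))// ler_wpM2l ?sqr_ge0//.
  by rewrite Lk exprS ler_peMr ?expR_ge0// exprn_ege1.
have -> : B / k = k * ((`|c| * `|y| ^+ 3 + (c * y) ^+ 2 * L) / k ^+ 2) * L.
  rewrite /B; field; exact: lt0r_neq0.
apply: ler_wpM2r; first exact: expR_ge0.
apply: ler_wpM2l; first exact: ltW.
rewrite (le_trans d)// mulrDl lerD//.
  have -> : `|u| = `|y| / k by rewrite /u normrM [X in _ * X]gtr0_norm ?invr_gt0.
  rewrite exprMn -mulrA ler_wpM2l// ler_wpM2l//.
  by rewrite exprVn lef_pV2 ?posrE ?exprn_gt0// ler_weXn2l.
rewrite /u mulrA exprMn exprVn mulrAC//.
Qed.

End GaussianLimits.

(** * Exponential moments from a Gaussian characteristic function *)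

Section SignWalk.
Variable R : realType.
Implicit Types (g h : R -> R) (u x c : R).

(** The expectation of [g] at the end of a walk of [m] fair steps [+ u] or [- u]
    from [x], as an iterated average. *)
Fixpoint sign_walk (m : nat) u g x : R :=
  if m is k.+1 then (sign_walk k u g (x + u) + sign_walk k u g (x - u)) / 2
  else g x.

Lemma sign_walkD m u g h x a b :
  sign_walk m u (fun y => a * g y + b * h y) x =
  a * sign_walk m u g x + b * sign_walk m u h x.
Proof. by elim: m x => //= m IH x; rewrite !IH; field. Qed.

Lemma le_sign_walk m u g h x : (forall y, g y <= h y) ->
  sign_walk m u g x <= sign_walk m u h x.
Proof. by move=> gh; elim: m x => //= m IH x; have := IH (x + u); have := IH (x - u); lra. Qed.

Lemma sign_walk_cos m u s t x :
  sign_walk m u (fun y => cos (s * y + t)) x = cos (s * u) ^+ m * cos (s * x + t).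
Proof.
elim: m x => [x|m IH x] /=; first by rewrite expr0 mul1r.
rewrite !IH.
have -> : s * (x + u) + t = (s * x + t) + s * u by ring.
have -> : s * (x - u) + t = (s * x + t) - s * u by ring.
by rewrite cosD cosB exprS; field.
Qed.

Lemma sign_walk_expR m u c x :
  sign_walk m u (fun y => expR (c * y)) x =
  ((expR (c * u) + expR (- (c * u))) / 2) ^+ m * expR (c * x).
Proof.
elim: m x => [x|m IH x] /=; first by rewrite expr0 mul1r.
by rewrite !IH mulrDr mulrBr !expRD exprS; field.
Qed.

Lemma cosh_le w : (expR w + expR (- w)) / 2 <= expR (w ^+ 2 * expR `|w|) :> R.
Proof.
apply: le_trans (expR_ge1Dx _).
have /(le_trans (ler_norm _)) b1 := expR_bound2 w.
have /(le_trans (ler_norm _)) b2 := expR_bound2 (- w).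
by move: b1 b2; rewrite normrN sqrrN; lra.
Qed.

(** Each step contributes a factor [cosh w <= exp (w^2 exp |w|)], and the squares
    [w^2] add up to [c^2 v] whatever the number of steps. *)
Lemma sign_walk_expR_le v c m : 0 <= v ->
  sign_walk m.+1 (Num.sqrt (v / m.+1%:R)) (fun y => expR (c * y)) 0 <=
  expR (c ^+ 2 * v * expR (`|c| * Num.sqrt v)).
Proof.
move=> v0; rewrite sign_walk_expR mulr0 expR0 mulr1.
set w := c * _.
have k0 : 0 < m.+1%:R :> R by rewrite ltr0n.
have w2 : w ^+ 2 = c ^+ 2 * v / m.+1%:R.
  by rewrite exprMn sqr_sqrtr ?mulrA// divr_ge0// ltW.
have wb : `|w| <= `|c| * Num.sqrt v.
  rewrite normrM ler_wpM2l// ger0_norm ?sqrtr_ge0// ler_wsqrtr//.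
  by rewrite ler_pdivrMr// ler_peMr// ler1n.
have -> : c ^+ 2 * v * expR (`|c| * Num.sqrt v) =
   m.+1%:R * (w ^+ 2 * expR (`|c| * Num.sqrt v)).
  by rewrite w2; field; exact: lt0r_neq0.
rewrite expRM_natl; apply: lerXn2r.
- by rewrite nnegrE divr_ge0// addr_ge0// expR_ge0.
- by rewrite nnegrE expR_ge0.
rewrite (le_trans (cosh_le w))// ler_expR ler_wpM2l ?sqr_ge0//.
by rewrite ler_expR.
Qed.

End SignWalk.

Section GaussianMoments.
Context d (T : measurableType d) (R : realType) (P : probability T R).
Variables (Y : T -> R) (v : R).
Hypotheses (mY : measurable_fun [set: T] Y) (v0 : 0 <= v).
Hypothesis cosY : forall s, (\int[P]_x cos (s * Y x) = expR (- (s ^+ 2 * v / 2)))%R.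
Hypothesis sinY : forall s, (\int[P]_x sin (s * Y x) = 0)%R.

Let step m := Num.sqrt (v / m.+1%:R).

Lemma bounded_integrable (g : R -> R) (M : R) :
  measurable_fun [set: R] g -> (forall y, `|g y| <= M) ->
  P.-integrable [set: T] (EFin \o (g \o Y)).
Proof.
move=> mg gM; apply: (@le_integrable _ _ _ _ _ _ _ (cst M%:E)) => //.
- by apply/measurable_EFinP; exact: measurableT_comp.
- by move=> x _ /=; rewrite lee_fin (le_trans (gM _))// ler_norm.
- exact: finite_measure_integrable_cst.
Qed.

Lemma measurable_sin_poly (c h : R) (n : nat) (s t : R) :
  measurable_fun [set: R] (fun y => (1 + c * sin (h * y)) ^+ n * cos (s * y + t)).
Proof.
apply: continuous_measurable_fun => x.
apply: cvgM; last first.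
  apply: (continuous_comp (f := fun y => s * y + t)); last exact: continuous_cos.
  by apply: cvgD; [apply: cvgMr|exact: cvg_cst].
apply: (continuous_comp (f := fun y => 1 + c * sin (h * y)) (g := fun z => z ^+ n)); last first.
  exact: exprn_continuous.
apply: cvgD; first exact: cvg_cst.
apply: cvgMr.
apply: (continuous_comp (f := fun y => h * y)); last exact: continuous_sin.
exact: cvgMr.
Qed.

Lemma sin_poly_bounded (c h : R) (n : nat) (s t y : R) :
  `|(1 + c * sin (h * y)) ^+ n * cos (s * y + t)| <= (1 + `|c|) ^+ n.
Proof.
rewrite normrM -[leRHS]mulr1; apply: ler_pM => //; last exact: cos_max.
rewrite normrX; apply: lerXn2r; rewrite ?nnegrE ?addr_ge0//.
rewrite (le_trans (ler_normD _ _))// normr1 lerD2l normrM ler_piMr//.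
exact: sin_max.
Qed.

(** Both sides are linear in the function, and on cosines they agree in the limit
    because [Y] and the walk have the same limiting characteristic function.
    Multiplication by [1 + c sin (h y)] keeps the span of the functions
    [cos (s y + t)], thanks to the free phase [t]. *)
Lemma cvg_sign_walk (c h : R) (n : nat) (s t : R) :
  sign_walk m.+1 (step m)
    (fun y => (1 + c * sin (h * y)) ^+ n * cos (s * y + t)) 0 @[m --> \oo] -->
  (\int[P]_x ((1 + c * sin (h * Y x)) ^+ n * cos (s * Y x + t)))%R.
Proof.
have integ n' s' t' : P.-integrable [set: T]
    (EFin \o (fun x => (1 + c * sin (h * Y x)) ^+ n' * cos (s' * Y x + t'))).
  exact: (bounded_integrable (measurable_sin_poly c h n' s' t') (sin_poly_bounded c h n' s' t')).
elim: n s t => [s t|n IH s t].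
  have -> : (\int[P]_x ((1 + c * sin (h * Y x)) ^+ 0 * cos (s * Y x + t)))%R =
      expR (- (s ^+ 2 * v / 2)) * cos t.
    have Ec x : (1 + c * sin (h * Y x)) ^+ 0 * cos (s * Y x + t) =
        cos t * cos (s * Y x) + (- sin t) * sin (s * Y x).
      by rewrite expr0 mul1r cosD; ring.
    under eq_Rintegral do rewrite Ec.
    have ic r : P.-integrable [set: T] (EFin \o (fun x => r * cos (s * Y x))).
      apply: (@bounded_integrable (fun y => r * cos (s * y)) `|r|) => [|y].
        apply: measurable_funM => //; apply: continuous_measurable_fun => x.
        by apply: (continuous_comp (f := fun y => s * y)); [exact: cvgMr|exact: continuous_cos].
      by rewrite normrM ler_piMr// cos_max.
    have isn r : P.-integrable [set: T] (EFin \o (fun x => r * sin (s * Y x))).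
      apply: (@bounded_integrable (fun y => r * sin (s * y)) `|r|) => [|y].
        apply: measurable_funM => //; apply: continuous_measurable_fun => x.
        by apply: (continuous_comp (f := fun y => s * y)); [exact: cvgMr|exact: continuous_sin].
      by rewrite normrM ler_piMr// sin_max.
    rewrite RintegralD// !RintegralZl//.
    - by rewrite cosY sinY mulr0 addr0 mulrC.
    - by under eq_fun do rewrite -[sin _]mul1r; exact: isn.
    - by under eq_fun do rewrite -[cos _]mul1r; exact: ic.
  under eq_fun do under eq_fun do rewrite expr0 mul1r.
  under eq_fun do rewrite sign_walk_cos mulr0 add0r.
  by apply: cvgMl; exact: cvg_cos_pow.
have E y : (1 + c * sin (h * y)) ^+ n.+1 * cos (s * y + t) =
   1 * ((1 + c * sin (h * y)) ^+ n * cos (s * y + t)) +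
   1 * (c / 2 * ((1 + c * sin (h * y)) ^+ n * cos ((s - h) * y + (t + pi / 2))) +
   (- c / 2) * ((1 + c * sin (h * y)) ^+ n * cos ((s + h) * y + (t + pi / 2)))).
  have -> : (s - h) * y + (t + pi / 2) = (s * y + t - h * y) + pi / 2 by ring.
  have -> : (s + h) * y + (t + pi / 2) = (s * y + t + h * y) + pi / 2 by ring.
  by rewrite !cosDpihalf (sinB (s * y + t)) (sinD (s * y + t)) exprS; field.
pose W m r' t' := sign_walk m.+1 (step m)
  (fun y => (1 + c * sin (h * y)) ^+ n * cos (r' * y + t')) 0.
have WE m : sign_walk m.+1 (step m)
    (fun y => (1 + c * sin (h * y)) ^+ n.+1 * cos (s * y + t)) 0 =
  1 * W m s t + 1 * (c / 2 * W m (s - h) (t + pi / 2) + (- c / 2) * W m (s + h) (t + pi / 2)).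
  by rewrite /W -!sign_walkD; congr (sign_walk _ _ _ _); apply/funext => y; exact: E.
under eq_fun do rewrite WE !mul1r.
under eq_Rintegral do rewrite E !mul1r.
have integZ r n' s' t' : P.-integrable [set: T] (EFin \o (fun x =>
    r * ((1 + c * sin (h * Y x)) ^+ n' * cos (s' * Y x + t')))).
  by have := integrableZl measurableT r (integ n' s' t').
rewrite RintegralD//; last first.
  exact: (integrableD measurableT (integZ (c / 2) n (s - h) (t + pi / 2))
    (integZ (- c / 2) n (s + h) (t + pi / 2))).
rewrite RintegralD// !RintegralZl//.
apply: cvgD; first exact: IH.
by apply: cvgD; apply: cvgMr; exact: IH.
Qed.

(** The functions [(1 + c sin (y / M)) ^ M] are trigonometric polynomials, so that
    their expectations are limits of the expectations for walks.  They are
    dominated by [exp |c y|], whose walk expectations are bounded; so the bound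
    [B] does not depend on [M].  Since they tend to [exp (c y)], Fatou's lemma
    concludes. *)
Lemma gaussian_expR_moment c : (\int[P]_x (expR (c * Y x))%:E < +oo)%E.
Proof.
set B := expR (`|c| ^+ 2 * v * expR (`|(`|c|)| * Num.sqrt v)) + expR ((- `|c|) ^+ 2 * v * expR (`|(- `|c|)| * Num.sqrt v)).
(* The even exponent [2 N + 2] makes [g N] nonnegative, as Fatou's lemma requires. *)
pose g (N : nat) y : R := (1 + c * sin (y / (2 * N.+1)%:R)) ^+ (2 * N.+1).
have gE N y : g N y = (1 + c * sin ((2 * N.+1)%:R^-1 * y)) ^+ (2 * N.+1) * cos (0 * y + 0).
  by rewrite mul0r addr0 cos0 mulr1 /g [_ * y]mulrC.
have g0 N y : 0 <= g N y by rewrite /g exprM exprn_ge0// sqr_ge0.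
have mg N : measurable_fun [set: R] (g N).
  by have -> : g N = _ := funext (gE N); exact: measurable_sin_poly.
have gexp N y : g N y <= expR (`|c| * y) + expR (- `|c| * y).
  rewrite -[g N y]ger0_norm// /g normrX.
  apply: (@le_trans _ _ (expR (`|c * y|))).
    set M := (2 * N.+1)%N.
    have M0 : 0 < M%:R :> R by rewrite ltr0n.
    have -> : expR `|c * y| = expR (`|c * y| / M%:R) ^+ M.
      by rewrite -expRM_natr; congr expR; field; exact: lt0r_neq0.
    apply: lerXn2r; rewrite ?nnegrE ?expR_ge0//.
    rewrite (le_trans (ler_normD _ _))// normr1 (le_trans _ (expR_ge1Dx _))//.
    rewrite lerD2l !normrM -mulrA ler_wpM2l// (le_trans (sin_bound _))// normrM.
    by rewrite [X in _ * X]gtr0_norm ?invr_gt0.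
  rewrite normrM; have [y0|y0] := leP 0 y.
    by rewrite (ger0_norm y0) lerDl expR_ge0.
  by rewrite (ltr0_norm y0) mulrN mulNr lerDr expR_ge0.
have intg N : (\int[P]_x (g N (Y x))%:E <= B%:E)%E.
  have ig : P.-integrable [set: T] (EFin \o (g N \o Y)).
    apply: (@bounded_integrable _ ((1 + `|c|) ^+ (2 * N.+1))) => // y.
    by rewrite gE; exact: sin_poly_bounded.
  have -> : (\int[P]_x (g N (Y x))%:E = (\int[P]_x g N (Y x))%R%:E)%E.
    by rewrite /Rintegral fineK//; exact: integrable_fin_num ig.
  rewrite lee_fin.
  under eq_Rintegral do rewrite gE.
  have cv := @cvg_sign_walk c ((2 * N.+1)%:R^-1) (2 * N.+1) 0 0.
  rewrite -(cvg_lim _ cv)//; apply: limr_le; first by apply/cvg_ex; eexists; exact: cv.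
  apply: nearW => m.
  apply: le_trans (lerD (sign_walk_expR_le `|c| m v0) (sign_walk_expR_le (- `|c|) m v0)).
  rewrite -[X in _ <= X + _]mul1r -[X in _ <= _ + X]mul1r -sign_walkD.
  by apply: le_sign_walk => y; rewrite -gE !mul1r.
apply: (@le_lt_trans _ _ B%:E); last exact: ltry.
have := @fatou _ _ _ P setT measurableT (fun N x => (g N (Y x))%:E) _ _.
have -> : (fun x => limn_einf (fun N => (g N (Y x))%:E)) = (fun x => (expR (c * Y x))%:E).
  apply/funext => x; apply: (@cvg_limn_einf_sup _ _ _ _).1.
  apply/fine_cvgP; split; first exact: nearW.
  have dbl : (2 * N.+1).-1 @[N --> \oo] --> \oo%classic.
    move=> A [n _ nA]; exists n => // k /= nk; apply: nA => /=; lia.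
  have := cvg_comp _ _ dbl (@cvg_sin_pow R c (Y x)); apply: cvg_trans.
  by apply: near_eq_cvg; apply: nearW => N /=; rewrite /g mulnS.
move=> fat; apply: le_trans (fat _ _) _.
- by move=> N; apply/measurable_EFinP; exact: measurableT_comp.
- by move=> N x _; rewrite lee_fin.
rewrite limn_einf_lim; apply: lime_le; first exact: is_cvg_einfs.
apply: nearW => N; apply: le_trans (intg N).
by apply: ereal_inf_lbound; exists N => /=.
Qed.
End GaussianMoments.

(** * Complex sequences and the Cauchy product *)

Section ComplexSequences.
Variable R : realType.
Implicit Types (u w : nat -> R[i]) (a b z : R[i]).

(** Convergence of complex sequences through the real-valued modulus, so that all
    limits are taken in [R]. *)
Definition ccvg u a := normc (u N - a) @[N --> \oo] --> (0 : R).

Lemma normc_ge0 a : 0 <= normc a.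
Proof. by case: a => x y; exact: sqrtr_ge0. Qed.

Lemma normcR (x : R) : normc x%:C = `|x|.
Proof. by rewrite /= expr0n addr0 sqrtr_sqr. Qed.

Lemma normcX a n : normc (a ^+ n) = normc a ^+ n.
Proof. by elim: n => [|n IH]; rewrite ?expr0 ?normc1// !exprS normcM IH. Qed.

Lemma normc_sum n u : normc (\sum_(0 <= k < n) u k) <= \sum_(0 <= k < n) normc (u k).
Proof.
elim: n => [|n IH]; first by rewrite !big_nil normc0.
by rewrite !big_nat_recr//= (le_trans (le_normcD _ _))// lerD2r.
Qed.

Lemma normc_le_ReIm a : normc a <= `|complex.Re a| + `|complex.Im a|.
Proof.
have {1}-> : a = (complex.Re a)%:C + 'i * (complex.Im a)%:C by exact: complexE.
rewrite (le_trans (le_normcD _ _))// normcM !normcR lerD2l.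
by rewrite [normc 'i]/= expr0n add0r expr1n sqrtr1 mul1r.
Qed.

Lemma Re_le_normc a : `|complex.Re a| <= normc a.
Proof.
case: a => x y /=; rewrite -sqrtr_sqr ler_wsqrtr// lerDl; exact: sqr_ge0.
Qed.

Lemma Im_le_normc a : `|complex.Im a| <= normc a.
Proof.
case: a => x y /=; rewrite -sqrtr_sqr ler_wsqrtr// lerDr; exact: sqr_ge0.
Qed.

Lemma ccvg_le u a (e : nat -> R) : (forall N, normc (u N - a) <= e N) ->
  e N @[N --> \oo] --> 0 -> ccvg u a.
Proof.
move=> ue e0; apply: (squeeze_cvgr (f := cst 0) (h := e)) => //; last exact: cvg_cst.
by apply: nearW => N; rewrite normc_ge0 ue.
Qed.

Lemma ccvgE u a : ccvg u a <->
  (complex.Re (u N) @[N --> \oo] --> complex.Re a) /\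
  (complex.Im (u N) @[N --> \oo] --> complex.Im a).
Proof.
split=> [ua|[ur ui]].
  have part (f : R[i] -> R) : (forall z, `|f z| <= normc z) ->
      (forall z z', f (z - z') = f z - f z') -> f (u N) @[N --> \oo] --> f a.
    move=> fle fB; apply/subr_cvg0; apply/norm_cvg0P.
    apply: (squeeze_cvgr (f := cst 0) (h := fun N => normc (u N - a))) => //; last exact: cvg_cst.
    by apply: nearW => N; rewrite normr_ge0 -fB fle.
  split; first by apply: part; [exact: Re_le_normc|move=> [? ?] [? ?]].
  by apply: part; [exact: Im_le_normc|move=> [? ?] [? ?]].
apply: (@ccvg_le _ _ (fun N => `|complex.Re (u N) - complex.Re a| + `|complex.Im (u N) - complex.Im a|)).
  move=> N; rewrite (le_trans (normc_le_ReIm _))//.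
  by case: (u N) => ? ?; case: a {ur ui} => ? ?.
rewrite -[X in _ --> X]addr0; apply: cvgD; apply/norm_cvg0P; exact/subr_cvg0.
Qed.

Lemma ccvgD u w a b : ccvg u a -> ccvg w b -> ccvg (fun N => u N + w N) (a + b).
Proof.
move=> ua wb; apply: (@ccvg_le _ _ (fun N => normc (u N - a) + normc (w N - b))).
  by move=> N; rewrite opprD addrACA le_normcD.
by rewrite -[X in _ --> X]addr0; exact: cvgD.
Qed.

Lemma ccvgMr u a b : ccvg u a -> ccvg (fun N => b * u N) (b * a).
Proof.
move=> ua; apply: (@ccvg_le _ _ (fun N => normc b * normc (u N - a))).
  by move=> N; rewrite -mulrBr normcM.
by rewrite -[X in _ --> X](mulr0 (normc b)); exact: cvgMr.
Qed.

Lemma cvg_ccvg u a : (u N @[N --> \oo] --> (a : (R[i])^o)) -> ccvg u a.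
Proof.
move=> /(@cvgrPdist_lt _ (R[i])^o) ua; apply/cvgrPdist_lt => e e0.
have := ua e%:C; rewrite ltcR => /(_ e0); apply: filterS => N h.
rewrite sub0r normrN ger0_norm ?normc_ge0//.
have : (`|a - u N : R[i]| < e%:C)%R := h.
by rewrite distrC normc_def ltcR; case: (u N - a).
Qed.

(** The terms with [N - j] large are small because [e] tends to [0], the others
    because [a] is summable. *)
Lemma cvg_convolution_null (a e : nat -> R) : (forall n, 0 <= a n) ->
  (forall n, 0 <= e n) -> cvgn (series a) -> e n @[n --> \oo] --> 0 ->
  \sum_(0 <= j < N) a j * e (N - j)%N @[N --> \oo] --> 0.
Proof.
move=> a0 e0 ca ce.
have [A aA] : exists A, forall n, series a n <= A.
  exists (limn (series a)) => n; apply: nondecreasing_cvgn_le => //.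
  exact: nondecreasing_series.
have [M eM] : exists M, forall n, e n <= M.
  have /cvg_seq_bounded/bounded_fun_has_ubound[M Mub] : cvgn e by apply/cvg_ex; exists 0.
  by exists M => n; apply: Mub; exists n.
have A0 : 0 <= A by have := aA 0%N; rewrite /series/= big_nil.
have M0 : 0 <= M by exact: le_trans (eM 0%N).
apply/cvgrPdist_le => r r0.
pose q := r / (A + M + 1).
have q0 : 0 < q by rewrite divr_gt0//; lra.
have /cvgrPdist_le/(_ _ q0)[K _ eK] := ce.
have /cvgrPdist_le/(_ _ q0)[L _ aL] := ca.
near=> N.
rewrite sub0r normrN ger0_norm; last by apply: sumr_ge0 => j _; rewrite mulr_ge0.
have LN : (L + K <= N)%N by near: N; exists (L + K)%N.
rewrite (big_cat_nat (n := L))//=; last by lia.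
have s1 : \sum_(0 <= j < L) a j * e (N - j)%N <= A * q.
  apply: (@le_trans _ _ (\sum_(0 <= j < L) a j * q)).
    apply: ler_sum_nat => j /andP[_ jL]; rewrite ler_wpM2l//.
    have := eK (N - j)%N; rewrite /= sub0r normrN ger0_norm//; apply; lia.
  by rewrite -mulr_suml; apply: ler_wpM2r; [exact: ltW|exact: (aA L)].
have s2 : \sum_(L <= j < N) a j * e (N - j)%N <= q * M.
  apply: (@le_trans _ _ (\sum_(L <= j < N) a j * M)).
    by apply: ler_sum_nat => j _; rewrite ler_wpM2l.
  rewrite -mulr_suml ler_wpM2r//.
  have -> : \sum_(L <= j < N) a j = series a N - series a L.
    by rewrite sub_series_geq//; lia.
  have l1 : series a N <= limn (series a).
    by apply: nondecreasing_cvgn_le => //; exact: nondecreasing_series.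
  have := aL L (leqnn L); rewrite ler_norml => /andP[_]; lra.
rewrite (le_trans (lerD s1 s2))//.
rewrite mulrC -mulrDr /q mulrAC ler_pdivrMr; last by lra.
by rewrite ler_wpM2l ?(ltW r0)//; lra.
Unshelve. all: by end_near. Qed.

(** Mertens' theorem.  The error is the convolution of the absolutely summable [u]
    with the errors of the partial sums of [w]. *)
Lemma cauchy_product u w a b :
  cvgn (series (fun n => normc (u n))) ->
  ccvg (fun N => \sum_(0 <= n < N) u n) a ->
  ccvg (fun N => \sum_(0 <= n < N) w n) b ->
  ccvg (fun N => \sum_(0 <= n < N) \sum_(0 <= j < n.+1) u j * w (n - j)%N) (a * b).
Proof.
move=> cu ua wb.
pose S N := \sum_(0 <= n < N) w n.
have E N : \sum_(0 <= n < N) \sum_(0 <= j < n.+1) u j * w (n - j)%N =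
  \sum_(0 <= j < N) u j * S (N - j)%N.
  elim: N => [|N IH]; first by rewrite !big_nil.
  rewrite big_nat_recr//= IH big_nat_recr//= [in RHS]big_nat_recr//= addrA.
  rewrite subSn// subnn /S big_nat1; congr (_ + _).
  rewrite -big_split/=; apply: eq_big_nat => j /andP[_ jN].
  by rewrite subSn 1?ltnW// big_nat_recr//= mulrDr.
have -> : (fun N => \sum_(0 <= n < N) \sum_(0 <= j < n.+1) u j * w (n - j)%N) =
    (fun N => b * (\sum_(0 <= j < N) u j) + \sum_(0 <= j < N) u j * (S (N - j)%N - b)).
  apply/funext => N; rewrite E mulr_sumr -big_split/=.
  by apply: eq_bigr => j _; ring.
rewrite [a * b]mulrC -[X in ccvg _ X]addr0; apply: ccvgD; first exact: ccvgMr.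
have := @cvg_convolution_null (fun n => normc (u n)) (fun N => normc (S N - b))
  (fun n => normc_ge0 _) (fun n => normc_ge0 _) cu wb.
apply: ccvg_le => N; rewrite subr0 (le_trans (normc_sum _ _))//.
by apply: ler_sum_nat => j _; rewrite normcM.
Qed.

End ComplexSequences.

(** * Power series and Hermite polynomials *)

Section PowerSeries.
Variable R : realType.
Implicit Types (s x y t v : R) (n k N : nat).

(** Convergence at [1] bounds the coefficients, so that near [0] the first nonzero
    term would dominate the rest of the series. *)
Lemma power_series_eq0 (a : nat -> R) :
  (forall s, \sum_(0 <= n < N) a n * s ^+ n @[N --> \oo] --> 0) ->
  forall n, a n = 0.
Proof.
move=> a0.
have [M aM] : exists M, forall n, `|a n| <= M.
  have /cvg_seq_bounded[M [_ Mb]] : cvgn (fun n => a n * 1 ^+ n).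
    apply/cvg_ex; exists 0; apply: cvg_series_cvg_0.
    by apply/cvg_ex; exists 0; exact: a0.
  exists (M + 1) => n; have := Mb (M + 1); rewrite ltrDl ltr01 => /(_ isT n I).
  by rewrite /= expr1n mulr1.
have M0 : 0 <= M by exact: le_trans (aM 0%N).
elim/ltn_ind => k IH; apply/eqP/negPn/negP => ak.
have ak0 : 0 < `|a k| by rewrite normr_gt0.
(* For this [s] the terms after the [k]-th, at most [2 M s^(k+1)] in all, amount
   to at most half of the [k]-th. *)
pose s := Num.min (1 / 2) (`|a k| / (4 * (M + 1))).
have M1 : 0 < 4 * (M + 1) by lra.
have s0 : 0 < s by rewrite lt_min; apply/andP; split; [lra|exact: divr_gt0].
have s2 : s <= 1 / 2 by rewrite ge_min lexx.
have sa : s * (4 * (M + 1)) <= `|a k|.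
  by rewrite -ler_pdivlMr// ge_min lexx orbT.
have geo N : \sum_(0 <= j < N) s ^+ j <= 2.
  have E : (1 - s) * \sum_(0 <= j < N) s ^+ j = 1 - s ^+ N.
    elim: N => [|N IHN]; first by rewrite big_nil mulr0 expr0 subrr.
    by rewrite big_nat_recr//= mulrDr IHN exprS; ring.
  have sN : 0 <= s ^+ N by rewrite exprn_ge0// ltW.
  rewrite -(ler_pM2l (x := 1 - s)); last by lra.
  by rewrite E; lra.
have bnd N : s ^+ k * (`|a k| / 2) <= `|\sum_(0 <= n < k.+1 + N) a n * s ^+ n|.
  rewrite (big_cat_nat (n := k.+1))//=; last by rewrite leq_addr.
  rewrite big_nat_recr//= big_nat_cond big1 ?add0r; last first.
    by move=> j; rewrite andbT => /andP[_ jk]; rewrite IH// mul0r.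
  rewrite -[X in \sum_(X <= _ < _) _]add0n big_addn addKn.
  have T : `|\sum_(0 <= i < N) a (i + k.+1)%N * s ^+ (i + k.+1)| <= s ^+ k.+1 * (M * 2).
    rewrite (le_trans (ler_norm_sum _ _ _))//.
    apply: (@le_trans _ _ (\sum_(0 <= i < N) s ^+ k.+1 * (M * s ^+ i))).
      apply: ler_sum_nat => i _.
      have -> : a (i + k.+1)%N * s ^+ (i + k.+1) = s ^+ k.+1 * (a (i + k.+1)%N * s ^+ i).
        by rewrite exprD; ring.
      rewrite !normrM !normrX (gtr0_norm s0) ler_wpM2l ?exprn_ge0 ?(ltW s0)//.
      by rewrite ler_wpM2r ?exprn_ge0 ?(ltW s0).
    rewrite -mulr_sumr -mulr_sumr; apply: ler_wpM2l; first by rewrite exprn_ge0// ltW.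
    exact: ler_wpM2l.
  have := lerB_normD (a k * s ^+ k) (\sum_(0 <= i < N) a (i + k.+1)%N * s ^+ (i + k.+1)).
  apply: le_trans; rewrite normrM normrX (gtr0_norm s0).
  rewrite lerBrDr; apply: (le_trans (lerD (lexx _) T)).
  rewrite exprS -[s * _]mulrC -mulrA -mulrDr mulrC ler_wpM2r ?exprn_ge0 ?(ltW s0)//.
  nra.
have := a0 s; rewrite -(cvg_shiftn k.+1) => /cvgrPdist_lt.
have p0 : 0 < s ^+ k * (`|a k| / 2) by rewrite mulr_gt0 ?exprn_gt0//; lra.
move=> /(_ _ p0)[N _ /(_ N (leqnn N))]/=.
by rewrite sub0r normrN addnC ltNge bnd.
Qed.

Lemma cvg_expR_series x : \sum_(0 <= n < N) x ^+ n / n`!%:R @[N --> \oo] --> expR x.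
Proof. exact: is_cvg_series_exp_coeff. Qed.

Lemma expR_partial_le x N : 0 <= x -> \sum_(0 <= n < N) x ^+ n / n`!%:R <= expR x.
Proof.
move=> x0; have := @nondecreasing_cvgn_le _ (series (exp_coeff x)).
by move=> /(_ (nondecreasing_series (fun n _ _ => divr_ge0 (exprn_ge0 n x0) (ler0n _ _)))
  (is_cvg_series_exp_coeff x) N).
Qed.

Lemma expR_term_le x n : 0 <= x -> x ^+ n / n`!%:R <= expR x.
Proof.
move=> x0; apply: le_trans (expR_partial_le n.+1 x0).
rewrite big_nat_recr//= lerDr sumr_ge0// => i _.
by rewrite divr_ge0// exprn_ge0.
Qed.

Lemma ccvg_expR_series x :
  ccvg (fun N => \sum_(0 <= n < N) (x%:C) ^+ n / n`!%:R) (expR x)%:C.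
Proof.
have E N : \sum_(0 <= n < N) (x%:C) ^+ n / n`!%:R = (\sum_(0 <= n < N) x ^+ n / n`!%:R)%:C.
  rewrite rmorph_sum/=; apply: eq_bigr => n _.
  by rewrite rmorphM/= rmorphXn fmorphV/= rmorph_nat.
apply/ccvgE; split; under eq_fun do rewrite E /=; last exact: cvg_cst.
exact: cvg_expR_series.
Qed.

Lemma ccvg_expi_series t :
  ccvg (fun N => \sum_(0 <= n < N) ('i * t%:C) ^+ n / n`!%:R) (cos t +i* sin t).
Proof.
have E n : ('i * t%:C) ^+ n / n`!%:R = cos_coeff t n +i* sin_coeff t n.
  have iE : ('i : R[i]) ^+ n = ((~~ odd n)%:R * (-1) ^+ n./2) +i* ((odd n)%:R * (-1) ^+ n.-1./2).
    rewrite -[in LHS](odd_double_half n) exprD -mul2n exprM sqr_i.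
    have -> : (-1 : R[i]) ^+ n./2 = ((-1) ^+ n./2)%:C by rewrite rmorphXn rmorphN rmorph1.
    have [on|en] := boolP (odd n).
      have -> : n.-1./2 = n./2 by rewrite -[in LHS](odd_double_half n) on/= doubleK.
      by rewrite expr1; simpc.
    by rewrite expr0; simpc.
  rewrite exprMn iE -(rmorph_nat (real_complex R)) -fmorphV -rmorphXn/= -mulrA -rmorphM/=.
  rewrite /cos_coeff /sin_coeff/=; simpc; rewrite !mulrA//.
have EN N : \sum_(0 <= n < N) ('i * t%:C) ^+ n / n`!%:R =
   (series (cos_coeff t) N) +i* (series (sin_coeff t) N).
  elim: N => [|N IH]; first by rewrite /series/= !big_nil.
  by rewrite big_nat_recr//= IH E /series/= !big_nat_recr.
apply/ccvgE; split; under eq_fun do rewrite EN /=.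
- by rewrite /= unlock; exact: is_cvg_series_cos_coeff.
- by rewrite /= unlock; exact: is_cvg_series_sin_coeff.
Qed.

(** Coefficients of [exp (r z^2)]. *)
Definition gauss_coef r k : R := if odd k then 0 else r ^+ k./2 / (k./2)`!%:R.

Lemma gauss_coefX r s k : s ^+ k * gauss_coef r k = gauss_coef (s ^+ 2 * r) k.
Proof.
rewrite /gauss_coef; case: ifPn => ok; first by rewrite mulr0.
by rewrite -{1}(even_halfK ok) -mul2n exprM [(_ * r) ^+ _]exprMn mulrA.
Qed.

Lemma gauss_coef_norm_le r k : `|gauss_coef r k| <= expR `|r|.
Proof.
rewrite /gauss_coef; case: ifPn => ok; first by rewrite normr0 expR_ge0.
by rewrite normrM normfV normr_nat normrX expR_term_le.
Qed.

Lemma cvg_gauss_coef r : \sum_(0 <= k < N) gauss_coef r k @[N --> \oo] --> expR r.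
Proof.
have E N : \sum_(0 <= k < N) gauss_coef r k = \sum_(0 <= k < uphalf N) r ^+ k / k`!%:R.
  elim: N => [|N IH]; first by rewrite !big_nil.
  rewrite big_nat_recr//= IH /gauss_coef uphalf_half.
  have [oN|eN] := boolP (odd N); first by rewrite addr0 add1n.
  by rewrite add0n big_nat_recr.
under eq_fun do rewrite E.
have half : uphalf N @[N --> \oo] --> \oo%classic.
  by move=> A [n _ nA]; exists (n.*2) => // k /= nk; apply: nA => /=; lia.
exact: (cvg_comp _ _ half (@cvg_expR_series r)).
Qed.

(** The coefficients in [z] of [exp (z x - z^2 v / 2)], that is the Hermite
    polynomials of variance [v] over [n!]. *)
Definition hermite_coef x v n : R :=
  \sum_(0 <= j < n.+1) (x ^+ j / j`!%:R) * gauss_coef (- (v / 2)) (n - j).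

(** The generating function at radius [r], with all terms made positive, dominates
    each of its terms. *)
Lemma hermite_coef_bound x v r n : 0 <= r -> 0 <= v ->
  `|hermite_coef x v n| * r ^+ n <= expR (r * `|x| + r ^+ 2 * v / 2).
Proof.
move=> r0 v0.
rewrite -[X in _ * X]ger0_norm ?exprn_ge0// -normrM mulr_suml expRD.
rewrite (le_trans (ler_norm_sum _ _ _))//.
apply: (@le_trans _ _ (\sum_(0 <= j < n.+1)
  (r * `|x|) ^+ j / j`!%:R * expR (r ^+ 2 * v / 2))).
  apply: ler_sum_nat => j /andP[_ jn].
  have -> : x ^+ j / j`!%:R * gauss_coef (- (v / 2)) (n - j) * r ^+ n =
    (r * x) ^+ j / j`!%:R * gauss_coef (r ^+ 2 * - (v / 2)) (n - j).
    have -> : r ^+ n = r ^+ j * r ^+ (n - j) by rewrite -exprD subnKC.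
    by rewrite -gauss_coefX exprMn; ring.
  rewrite normrM; apply: ler_pM => //.
    by rewrite normrM normfV normr_nat normrX normrM (ger0_norm r0).
  rewrite (le_trans (gauss_coef_norm_le _ _))// ler_expR.
  by rewrite mulrN normrN ger0_norm ?mulrA// !mulr_ge0// sqr_ge0.
rewrite -mulr_suml ler_wpM2r ?expR_ge0// expR_partial_le//.
exact: mulr_ge0.
Qed.

(** Real [z] serves to identify Wick powers, imaginary [z] to expand the functions
    [exp (i t <., F>)]; both have a real square [q].  The limit [e] stands for
    [exp (z x)], which has a different form in the two cases. *)
Lemma hermite_generating x v (z e : R[i]) (q : R) :
  z ^+ 2 = q%:C ->
  ccvg (fun N => \sum_(0 <= n < N) (z * x%:C) ^+ n / n`!%:R) e ->
  ccvg (fun N => \sum_(0 <= n < N) z ^+ n * (hermite_coef x v n)%:C)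
    (e * (expR (- (q * v / 2)))%:C).
Proof.
move=> zq ze.
pose w k : R[i] := (gauss_coef (- (q * v / 2)) k)%:C.
have wE k : w k = z ^+ k * (gauss_coef (- (v / 2)) k)%:C.
  rewrite /w /gauss_coef; case: ifPn => ok; first by rewrite mulr0.
  rewrite -{3}(even_halfK ok) -mul2n exprM zq -rmorphXn -rmorphM/= mulrA -exprMn.
  by rewrite mulrN !mulrA.
have hE n : z ^+ n * (hermite_coef x v n)%:C =
  \sum_(0 <= j < n.+1) (z * x%:C) ^+ j / j`!%:R * w (n - j)%N.
  rewrite /hermite_coef rmorph_sum mulr_sumr; apply: eq_big_nat => j /andP[_ jn].
  have -> : z ^+ n = z ^+ j * z ^+ (n - j) by rewrite -exprD subnKC.
  rewrite wE exprMn !rmorphM/= rmorphXn fmorphV/= rmorph_nat.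
  ring.
under eq_fun do under eq_bigr do rewrite hE.
apply: cauchy_product => //.
- apply: (@series_le_cvg _ _ (exp_coeff (normc z * `|x|))).
  + by move=> n; exact: normc_ge0.
  + by move=> n; rewrite divr_ge0// exprn_ge0// mulr_ge0// normc_ge0.
  + move=> n; rewrite normcM normcV -(rmorph_nat (real_complex R)) normcR normcX normcM normcR.
    by rewrite normr_nat lexx.
  + exact: is_cvg_series_exp_coeff.
have WE N : \sum_(0 <= n < N) w n = (\sum_(0 <= n < N) gauss_coef (- (q * v / 2)) n)%:C.
  by rewrite rmorph_sum.
apply/ccvgE; split; under eq_fun do rewrite WE /=; last exact: cvg_cst.
exact: cvg_gauss_coef.
Qed.

End PowerSeries.

(** * Finite Hermitian matrices *)

Section FiniteMatrices.
Variable R : realType.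
Implicit Types (A : hmatrix R) (F G : finhmatrix R) (M : nat -> nat -> R[i]).

Definition box N : seq (nat * nat) :=
  [seq (k, l) | k <- index_iota 0 N, l <- index_iota 0 N].

Lemma box_uniq N : uniq (box N).
Proof. by apply: allpairs_uniq; rewrite ?iota_uniq// => -[? ?] [? ?]. Qed.

Lemma mem_box N kl : (kl \in box N) = (kl.1 < N)%N && (kl.2 < N)%N.
Proof.
apply/allpairsP/andP => [[[k l] [/=]]|[kN lN]].
  by rewrite !mem_index_iota => /andP[_ kN] /andP[_ lN] ->.
by exists kl; rewrite !mem_index_iota -surjective_pairing.
Qed.

Definition supported N M := forall k l, ~~ ((k < N)%N && (l < N)%N) -> M k l = 0.

Lemma supported_leq N N' M : (N <= N')%N -> supported N M -> supported N' M.
Proof.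
move=> NN' sM k l kl; apply: sM; apply: contra kl => /andP[kN lN].
by rewrite (leq_trans kN)// (leq_trans lN).
Qed.

Lemma supported_finite N M : supported N M -> finite_set [set kl | M kl.1 kl.2 != 0].
Proof.
move=> sM; apply: (sub_finite_set (B := [set` box N])); last exact: finite_seq.
by move=> kl /= Mkl; rewrite mem_box; apply: contra_neqT Mkl; exact: sM.
Qed.

Lemma finhmatrix_supported F : exists N, supported N F.
Proof.
have /finite_seqP[s sF] := finhmatrixP F.
exists (\max_(kl <- s) (maxn kl.1 kl.2).+1) => k l kl.
apply/eqP; apply: contraNT kl => Fkl.
have ks : (k, l) \in s by have : [set` s] (k, l) by rewrite -sF.
have /= := leq_bigmax_seq (F := fun kl : nat * nat => (maxn kl.1 kl.2).+1) (P := xpredT) (k, l) ks isT.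
lia.
Qed.

Lemma fsum_box N (f : nat * nat -> R[i]) : (forall kl, kl \notin box N -> f kl = 0) ->
  \sum_(kl \in [set: nat * nat]) f kl = \sum_(0 <= k < N) \sum_(0 <= l < N) f (k, l).
Proof.
move=> f0; rewrite (fsbigE (box N)) ?box_uniq//; last by move=> kl _; exact: f0.
under eq_bigl do rewrite in_setT.
by rewrite big_allpairs.
Qed.

Lemma mpairE N A F : supported N F ->
  mpair A F = \sum_(0 <= k < N) \sum_(0 <= l < N) A k l * F l k.
Proof.
move=> sF; apply: fsum_box => kl; rewrite mem_box => klN.
by rewrite sF ?mulr0// andbC.
Qed.

(** This makes the bilinearity of the pairing available for the exponent of the
    [T]-transform. *)
Lemma mtr_mprod F G : mtr (mprod F G) = mpair F G.
Proof.
have [N sF] := finhmatrix_supported F; have [N' sG] := finhmatrix_supported G.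
have {}sF := supported_leq (leq_maxl N N') sF.
have {}sG := supported_leq (leq_maxr N N') sG.
move: (maxn N N') sF sG => {N'} {}N sF sG.
have fsum_nat (f : nat -> R[i]) : (forall k, (N <= k)%N -> f k = 0) ->
    \sum_(k \in [set: nat]) f k = \sum_(0 <= k < N) f k.
  move=> f0; rewrite (fsbigE (index_iota 0 N)) ?iota_uniq//.
    by under eq_bigl do rewrite in_setT.
  by move=> k _; rewrite mem_index_iota/= -leqNgt; exact: f0.
have prodE k : mprod F G k k = \sum_(0 <= l < N) F k l * G l k.
  by apply: fsum_nat => l Nl; rewrite sF ?mul0r//; lia.
rewrite (mpairE _ sG) /mtr fsum_nat => [|k Nk].
  by apply: eq_bigr => k _; exact: prodE.
by rewrite prodE big1// => l _; rewrite sF ?mul0r//; lia.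
Qed.

(** Conjugation exchanges the roles of rows and columns in the double sum. *)
Lemma mpair_real A F : mpair A F = (complex.Re (mpair A F))%:C.
Proof.
have conjE : (mpair A F)^* = mpair A F.
  have [N sF] := finhmatrix_supported F.
  rewrite (mpairE _ sF) rmorph_sum exchange_big/=; apply: eq_bigr => k _.
  rewrite rmorph_sum; apply: eq_bigr => l _.
  by rewrite rmorphM/= -!hmatrixP.
move: (mpair A F) conjE => [x y] [/eqP]; rewrite eq_sym -subr_eq0 opprK -mulr2n.
by rewrite mulrn_eq0/= => /eqP->.
Qed.

Fact hcomb_subproof (a b : R) (A B : hmatrix R) k l :
  a%:C * A l k + b%:C * B l k = (a%:C * A k l + b%:C * B k l)^*.
Proof. by rewrite rmorphD !rmorphM/= -!hmatrixP /= oppr0. Qed.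

Fact hcomb_finite (a b : R) F G :
  finite_set [set kl | HMatrix (hcomb_subproof a b F G) kl.1 kl.2 != 0].
Proof.
have [N sF] := finhmatrix_supported F; have [N' sG] := finhmatrix_supported G.
apply: (@supported_finite (maxn N N')) => k l kl /=.
rewrite (supported_leq (leq_maxl N N') sF)// (supported_leq (leq_maxr N N') sG)//.
by rewrite !mulr0 addr0.
Qed.

Definition hcomb (a b : R) F G := FinHMatrix (hcomb_finite a b F G).

Lemma hcomb_supported N a b F G : supported N F -> supported N G ->
  supported N (hcomb a b F G).
Proof. by move=> sF sG k l kl /=; rewrite sF// sG// !mulr0 addr0. Qed.

Lemma common_support F G : exists N, supported N F /\ supported N G.
Proof.
have [N sF] := finhmatrix_supported F; have [N' sG] := finhmatrix_supported G.
exists (maxn N N'); split; first exact: supported_leq (leq_maxl N N') sF.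
exact: supported_leq (leq_maxr N N') sG.
Qed.

Lemma mpair_hcombr A a b F G :
  mpair A (hcomb a b F G) = a%:C * mpair A F + b%:C * mpair A G.
Proof.
have [N [sF sG]] := common_support F G.
rewrite (mpairE _ (hcomb_supported a b sF sG)) (mpairE _ sF) (mpairE _ sG).
rewrite !mulr_sumr -big_split; apply: eq_bigr => k _ /=.
rewrite !mulr_sumr -big_split; apply: eq_bigr => l _ /=.
ring.
Qed.

Lemma mpair_hcombl a b F F' G :
  mpair (hcomb a b F F') G = a%:C * mpair F G + b%:C * mpair F' G.
Proof.
have [N sG] := finhmatrix_supported G.
rewrite !(mpairE _ sG).
rewrite !mulr_sumr -big_split; apply: eq_bigr => k _ /=.
rewrite !mulr_sumr -big_split; apply: eq_bigr => l _ /=.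
ring.
Qed.

Lemma msqnormE N F : supported N F ->
  msqnorm F = \sum_(0 <= k < N) \sum_(0 <= l < N) normc (F k l) ^+ 2.
Proof.
move=> sF; rewrite /msqnorm (fsbigE (box N)) ?box_uniq//.
  under eq_bigl do rewrite in_setT.
  by rewrite big_allpairs.
by move=> kl _; rewrite mem_box => klN; rewrite sF// normc0 expr0n.
Qed.

Lemma msqnorm_ge0 F : 0 <= msqnorm F.
Proof. by apply: fsumr_ge0 => kl _; exact: sqr_ge0. Qed.

Lemma msqnorm_scale a F G : msqnorm (hcomb a 0 F G) = a ^+ 2 * msqnorm F.
Proof.
have [N [sF sG]] := common_support F G.
rewrite (msqnormE (hcomb_supported a 0 sF sG)) (msqnormE sF) mulr_sumr.
apply: eq_bigr => k _; rewrite mulr_sumr; apply: eq_bigr => l _ /=.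
by rewrite mul0r addr0 normcM exprMn normcR real_normK ?num_real.
Qed.

Definition unit_entry (k l i j : nat) : R[i] := ((i == k) && (j == l))%:R.

Fact re_entry_subproof (m n k l : nat) :
  (unit_entry n m l k + unit_entry m n l k) / 2%:R =
  ((unit_entry n m k l + unit_entry m n k l) / 2%:R)^* :> R[i].
Proof.
rewrite /unit_entry rmorphM rmorphD fmorphV !rmorph_nat addrC.
by rewrite ![(l == _) && _]andbC.
Qed.

Fact im_entry_subproof (m n k l : nat) :
  (unit_entry n m l k - unit_entry m n l k) / (2%:R * 'i) =
  ((unit_entry n m k l - unit_entry m n k l) / (2%:R * 'i))^* :> R[i].
Proof.
have ci : (0 -i* 1 : R[i]) = - 'i by simpc.
rewrite /unit_entry rmorphM rmorphB fmorphV rmorphM !rmorph_nat/= ci.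
by rewrite ![(l == _) && _]andbC mulrN invrN mulrN -mulNr opprB.
Qed.

Lemma unit_entry_supported m n : supported (maxn m n).+1 (unit_entry m n).
Proof.
move=> k l kl; rewrite /unit_entry; case: (eqVneq k m) => //= km.
by case: (eqVneq l n) => //= ln; move: kl; rewrite km ln; lia.
Qed.

Fact re_entry_supported m n : supported (maxn m n).+1 (HMatrix (re_entry_subproof m n)).
Proof.
move=> k l kl /=; rewrite (unit_entry_supported kl).
by move: kl; rewrite maxnC => /unit_entry_supported ->; rewrite addr0 mul0r.
Qed.

Fact im_entry_supported m n : supported (maxn m n).+1 (HMatrix (im_entry_subproof m n)).
Proof.
move=> k l kl /=; rewrite (unit_entry_supported kl).
by move: kl; rewrite maxnC => /unit_entry_supported ->; rewrite subr0 mul0r.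
Qed.

(** The Hermitian matrices whose pairings with [A] are the real and the imaginary
    part of [A m n].  As [mpair] transposes its second argument, the combination
    [re_entry m n + i im_entry m n] is the matrix unit at [(n, m)]. *)
Definition re_entry m n := FinHMatrix (supported_finite (@re_entry_supported m n)).
Definition im_entry m n := FinHMatrix (supported_finite (@im_entry_supported m n)).

Lemma re_im_entry m n k l :
  re_entry m n k l + 'i * im_entry m n k l = unit_entry n m k l.
Proof.
rewrite /=.
have i0 : ('i : R[i]) != 0 by rewrite eq_complex/= oner_eq0 andbF.
by field.
Qed.

Lemma mpair_entry A m n : mpair A (re_entry m n) + 'i * mpair A (im_entry m n) = A m n.
Proof.
rewrite (mpairE (F := re_entry m n) _ (@re_entry_supported m n)) (mpairE (F := im_entry m n) _ (@im_entry_supported m n)).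
have E k l : A k l * re_entry m n l k + 'i * (A k l * im_entry m n l k) =
    A k l * unit_entry n m l k by rewrite -re_im_entry mulrDr ['i * (_ * _)]mulrCA.
transitivity (\sum_(0 <= k < (maxn m n).+1) \sum_(0 <= l < (maxn m n).+1)
    A k l * unit_entry n m l k).
  rewrite mulr_sumr -big_split; apply: eq_bigr => k _.
  by rewrite mulr_sumr -big_split; apply: eq_bigr => l _; exact: E.
rewrite /unit_entry.
rewrite (bigD1_seq m) ?iota_uniq ?mem_index_iota//=; last by lia.
rewrite (bigD1_seq n) ?iota_uniq ?mem_index_iota//=; last by lia.
rewrite !eqxx mulr1 !big1 ?addr0// => [k km|l ln].
  by rewrite big1// => l _; rewrite (negbTE km) andbF mulr0.
by rewrite (negbTE ln) mulr0.
Qed.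

End FiniteMatrices.

Section TestElements.
Variables (R : realType) (d : nat).
Implicit Types (F G : testM R d) (x : dualM R d) (a b : R).

Definition tcomb a b F G : testM R d :=
  (fun mu => hcomb a b (F.1 mu) (G.1 mu), fun mu => hcomb a b (F.2 mu) (G.2 mu)).

Definition tscale a F := tcomb a 0 F F.

Lemma pairing_tcomb x a b F G :
  pairing x (tcomb a b F G) = a%:C * pairing x F + b%:C * pairing x G.
Proof.
rewrite /pairing !mulr_sumr -big_split; apply: eq_bigr => mu _ /=.
rewrite !mpair_hcombr; ring.
Qed.

Lemma pairing_tscale x a F : pairing x (tscale a F) = a%:C * pairing x F.
Proof. by rewrite pairing_tcomb mul0r addr0. Qed.

Lemma sqnorm_ge0 F : 0 <= sqnorm F.
Proof. by apply: sumr_ge0 => mu _; rewrite addr_ge0// msqnorm_ge0. Qed.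

Lemma sqnorm_tscale a F : sqnorm (tscale a F) = a ^+ 2 * sqnorm F.
Proof.
rewrite /sqnorm mulr_sumr; apply: eq_bigr => mu _ /=.
by rewrite !msqnorm_scale mulrDr.
Qed.

Definition re_pairing F x : R := complex.Re (pairing x F).

Lemma pairingE x F : pairing x F = (re_pairing F x)%:C.
Proof.
rewrite /re_pairing /pairing raddf_sum rmorph_sum; apply: eq_bigr => mu _.
by rewrite raddfD rmorphD/= -!mpair_real.
Qed.

(** The bilinear form behind the exponent of the [T]-transform.  It pairs the
    components [A] of [F] with the components [B] of [G] and is not symmetric. *)
Definition tform F G : R[i] := \sum_(mu < d) mpair (F.1 mu) (G.2 mu).

Lemma tformE F : \sum_(mu < d) mtr (mprod (F.1 mu) (F.2 mu)) = tform F F.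
Proof. by apply: eq_bigr => mu _; exact: mtr_mprod. Qed.

Lemma tform_real F G : tform F G = (complex.Re (tform F G))%:C.
Proof.
rewrite /tform raddf_sum rmorph_sum; apply: eq_bigr => mu _.
exact: mpair_real.
Qed.

Lemma tform_tcombl a b F F' G :
  tform (tcomb a b F F') G = a%:C * tform F G + b%:C * tform F' G.
Proof.
rewrite /tform !mulr_sumr -big_split; apply: eq_bigr => mu _ /=.
by rewrite mpair_hcombl.
Qed.

Lemma tform_tcombr a b F G G' :
  tform F (tcomb a b G G') = a%:C * tform F G + b%:C * tform F G'.
Proof.
rewrite /tform !mulr_sumr -big_split; apply: eq_bigr => mu _ /=.
by rewrite mpair_hcombr.
Qed.

Definition hzero := hcomb 0 0 (re_entry R 0 0) (re_entry R 0 0).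

Definition tsingle (s : 'I_d + 'I_d) (F : finhmatrix R) : testM R d :=
  (fun mu => if s == inl mu then F else hzero,
   fun mu => if s == inr mu then F else hzero).

Definition component x (s : 'I_d + 'I_d) : hmatrix R :=
  match s with inl mu => x.1 mu | inr mu => x.2 mu end.

Lemma mpair0r (A : hmatrix R) : mpair A hzero = 0.
Proof. by rewrite mpair_hcombr !mul0r addr0. Qed.

Lemma mpair0l (F : finhmatrix R) : mpair hzero F = 0.
Proof. by rewrite mpair_hcombl !mul0r addr0. Qed.

Lemma pairing_tsingle x s (F : finhmatrix R) : pairing x (tsingle s F) = mpair (component x s) F.
Proof.
case: s => mu; rewrite /pairing (bigD1 mu)//= eqxx !mpair0r ?addr0 ?add0r big1 ?addr0//.
  move=> nu nm; have -> : (inl mu == inl nu :> 'I_d + 'I_d) = (mu == nu) by [].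
  by rewrite eq_sym (negbTE nm) !mpair0r addr0.
move=> nu nm; have -> : (inr mu == inr nu :> 'I_d + 'I_d) = (mu == nu) by [].
by rewrite eq_sym (negbTE nm) !mpair0r addr0.
Qed.

Lemma tform_AB mu nu (F G : finhmatrix R) :
  tform (tsingle (inl mu) F) (tsingle (inr nu) G) = (mu == nu)%:R * mpair F G.
Proof.
rewrite /tform (bigD1 mu)//= eqxx big1 ?addr0.
  have -> : (inr nu == inr mu :> 'I_d + 'I_d) = (mu == nu) by rewrite [RHS]eq_sym.
  by case: ifP; rewrite ?mul1r// mul0r mpair0r.
move=> k km; have -> : (inl mu == inl k :> 'I_d + 'I_d) = (k == mu) by rewrite [RHS]eq_sym.
by rewrite (negbTE km) mpair0l.
Qed.

Lemma tform_BX mu (F : finhmatrix R) G : tform (tsingle (inr mu) F) G = 0.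
Proof. by rewrite /tform big1// => nu _ /=; rewrite mpair0l. Qed.

Lemma tform_XA mu F (G : finhmatrix R) : tform F (tsingle (inl mu) G) = 0.
Proof. by rewrite /tform big1// => nu _ /=; rewrite mpair0r. Qed.

End TestElements.

(** * Norms of tensors *)

Section NonnegativeSums.
Context {R : realType} {T : choiceType}.
Local Open Scope ereal_scope.

Lemma esum_le_ub (A : set T) (a : T -> \bar R) (M : \bar R) :
  (forall X, fsets A X -> \sum_(i \in X) a i <= M) -> \esum_(i in A) a i <= M.
Proof. by move=> aM; apply: ge_ereal_sup => _ [X AX <-]; exact: aM. Qed.

Lemma le_esumZl (A : set T) (a : T -> \bar R) (c : R) : (0 <= c)%R ->
  (forall t, 0 <= a t) ->
  \esum_(i in A) (c%:E * a i) <= c%:E * \esum_(i in A) a i.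
Proof.
move=> c0 a0; apply: esum_le_ub => X [finX XA].
rewrite fsbig_finite// -ge0_sume_distrr//.
rewrite lee_wpmul2l ?lee_fin// -fsbig_finite//.
by apply: esum_ge; exists X.
Qed.

End NonnegativeSums.

Section TensorSums.
Variables (R : realType) (I : choiceType) (w : I -> R).
Hypothesis w0 : forall i, 0 <= w i.
Local Open Scope ereal_scope.

Let prod0 (s : seq I) : (0 <= \prod_(i <- s) w i)%R.
Proof. exact: prodr_ge0. Qed.

(** By splitting off the first index, the sum factorizes. *)
Lemma esum_tuple_prod_le (M : R) n : \esum_(i in [set: I]) (w i)%:E <= M%:E ->
  \esum_(t in [set: n.-tuple I]) (\prod_(i <- t) w i)%:E <= (M ^+ n)%:E.
Proof.
move=> wM.
elim: n => [|n IH].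
  have -> : [set: 0.-tuple I] = [set [tuple]].
    by apply/seteqP; split => t //= _; rewrite tuple0.
  by rewrite esum_set1 ?big_nil ?expr0// lee_fin.
pose h (k : I * n.-tuple I) : n.+1.-tuple I := [tuple of k.1 :: k.2].
rewrite (@reindex_esum _ _ _ [set: I * n.-tuple I] _ h); last first.
  split=> //.
  - move=> [i t] [j u] _ _ /(congr1 val)/= [-> tu].
    by congr (_, _); exact: val_inj.
  - by move=> t _; exists (thead t, [tuple of behead t]) => //; rewrite [RHS]tuple_eta.
have -> : [set: I * n.-tuple I] = [set: I] `*`` (fun=> [set: n.-tuple I]).
  by apply/seteqP; split.
rewrite -(esum_esum (a := fun i t => (\prod_(j <- h (i, t)) w j)%:E)); last first.
  by move=> i t; rewrite lee_fin.
apply: (@le_trans _ _ (\esum_(i in [set: I]) ((w i)%:E * (M ^+ n)%:E))).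
  apply: le_esum => i _.
  apply: (@le_trans _ _ ((w i)%:E * \esum_(t in [set: n.-tuple I]) (\prod_(j <- t) w j)%:E)).
    apply: le_trans (le_esumZl _ (w0 i) _) => [|t]; last by rewrite lee_fin.
    by apply: le_esum => t _; rewrite big_cons EFinM.
  by rewrite lee_wpmul2l ?lee_fin.
under eq_esum do rewrite muleC.
have M0 : (0 <= M)%R.
  by rewrite -lee_fin; apply: le_trans wM; apply: esum_ge0 => i _; rewrite lee_fin.
apply: (le_trans (le_esumZl _ _ _)) => [|i|]; rewrite ?exprn_ge0 ?lee_fin//.
by rewrite exprSr EFinM lee_wpmul2l// lee_fin exprn_ge0.
Qed.

End TensorSums.

Lemma finite_tuples (I : choiceType) (A : set I) n : finite_set A ->
  finite_set [set t : n.-tuple I | forall i, i \in (t : seq I) -> A i].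
Proof.
move=> finA; elim: n => [|n IH].
  by apply: (sub_finite_set (B := [set [tuple]])) => // t _ /=; rewrite tuple0.
apply: (sub_finite_set (B := [set [tuple of i :: t] | i in A & t in
  [set t : n.-tuple I | forall i, i \in (t : seq I) -> A i]])); last exact: finite_image2.
move=> t /= tA; exists (thead t).
  by apply: tA; rewrite [in X in _ \in X](tuple_eta t) mem_head.
exists [tuple of behead t]; last by rewrite [RHS]tuple_eta.
by move=> i it; apply: tA; rewrite (tuple_eta t) in_cons it orbT.
Qed.

Section Tensors.
Variables (R : realType) (d : nat).
Implicit Types (F G : testM R d) (x : dualM R d) (n : nat) (p : nat -> nat -> R).

Lemma normc_prod (I : Type) (s : seq I) (f : I -> R[i]) :
  normc (\prod_(i <- s) f i) = \prod_(i <- s) normc (f i).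
Proof. by elim: s => [|i s IH]; rewrite ?big_nil ?normc1// !big_cons normcM IH. Qed.

Lemma entry_support_finite F : finite_set [set i | entry (testM_dual F) i != 0].
Proof.
have fin (s : 'I_d + 'I_d) : finite_set [set kl | entry (testM_dual F) (s, kl) != 0].
  by case: s => mu; exact: finhmatrixP.
apply: (sub_finite_set (B := \bigcup_(s in [set: 'I_d + 'I_d])
   ((fun kl => (s, kl)) @` [set kl | entry (testM_dual F) (s, kl) != 0]))).
  by move=> [s kl] /= h; exists s => //; exists kl.
apply: bigcup_finite => [|s _]; first exact: finite_finset.
exact: finite_image.
Qed.

Lemma tpow_symmetric F n : symmetric_tensor (@tpow R d F n).
Proof. by move=> t u tu; exact: perm_big. Qed.

Lemma tpow_finite F n : finite_tensor (@tpow R d F n).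
Proof.
apply: sub_finite_set (finite_tuples n (entry_support_finite F)) => t /= + i it.
by apply: contra_neq => i0; apply/eqP; rewrite prodf_seq_eq0; apply/hasP; exists i => //=; apply/eqP.
Qed.

Lemma tpow_tscale F n s (t : n.-tuple (idx d)) : tpow (tscale s F) t = s%:C ^+ n * tpow F t.
Proof.
rewrite /tpow; transitivity (s%:C ^+ size t * \prod_(i <- t) entry (testM_dual F) i); last first.
  by rewrite size_tuple.
have E i : entry (testM_dual (tscale s F)) i = s%:C * entry (testM_dual F) i.
  by case: i => [[mu|mu] [k l]]; rewrite /entry/= mul0r addr0.
elim: (tval t) => [|i u IH]; first by rewrite !big_nil mulr1.
by rewrite !big_cons IH E /= exprS; ring.
Qed.

Lemma tpairZ n (S g : tensor R d n) (c : R[i]) :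
  tpair S (fun t => c * g t) = c * tpair S g.
Proof. by rewrite /tpair mulr_fsumr; apply: eq_fsbigr => t _; rewrite mulrCA. Qed.

Lemma flipK : involutive (@flip d).
Proof. by move=> [s [k l]]. Qed.

Lemma map_flipK n : involutive (@map_tuple n _ _ (@flip d)).
Proof. by move=> t; apply: val_inj => /=; rewrite mapK//; exact: flipK. Qed.

(** A sum with infinite support is [0] by convention, which would spoil additivity
    in general; hence the restriction to finite tensors. *)
Lemma tpairD n (S g h : tensor R d n) : finite_tensor g -> finite_tensor h ->
  tpair S (fun t => g t + h t) = tpair S g + tpair S h.
Proof.
move=> fg fh.
have [s sE] : exists s : seq (n.-tuple (idx d)), uniq s /\
    forall t, t \notin s -> g (map_tuple (@flip d) t) = 0 /\ h (map_tuple (@flip d) t) = 0.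
  have fin : finite_set ([set t | g t != 0] `|` [set t | h t != 0]) by rewrite finite_setU.
  have /finite_seqP[s sP] := finite_image (map_tuple (@flip d)) fin.
  exists (undup s); split; first exact: undup_uniq.
  move=> t; rewrite mem_undup => ts.
  have nt : ~ [set` s] t by exact/negP.
  split; apply/eqP/negPn/negP => h0; apply: nt; rewrite -sP;
    exists (map_tuple (@flip d) t); rewrite ?map_flipK//; [left|right] => //.
case: sE => us s0.
have E f : (forall t, t \notin s -> f (map_tuple (@flip d) t) = 0) ->
    tpair S f = \sum_(t <- s) S t * f (map_tuple (@flip d) t).
  move=> f0; rewrite /tpair (fsbigE s)//; first by under eq_bigl do rewrite in_setT.
  by move=> t _ ts; rewrite f0// mulr0.
rewrite !E ?big_split/=.
- by rewrite -big_split/=; apply: eq_bigr => t _; rewrite mulrDr.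
- by move=> t /s0[].
- by move=> t /s0[].
- by move=> t /s0[-> ->]; rewrite addr0.
Qed.

Lemma weight_ge0 (p : nat -> nat -> R) k l : weight p -> 0 <= p k l.
Proof. by move=> [_ p1]; apply: le_trans (p1 k l). Qed.

Lemma tsqnorm_ge0 p n (g : tensor R d n) : (forall k l, 0 <= p k l) ->
  (0 <= tsqnorm p g)%E.
Proof.
move=> p0; apply: esum_ge0 => t _; rewrite lee_fin mulr_ge0 ?sqr_ge0//.
by apply: prodr_ge0.
Qed.

Lemma normc_comb_sqr (c a b : R[i]) :
  normc (c * a + b) ^+ 2 <= 2 * normc c ^+ 2 * normc a ^+ 2 + 2 * normc b ^+ 2.
Proof.
have : normc (c * a + b) <= normc c * normc a + normc b.
  by rewrite (le_trans (le_normcD _ _))// normcM.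
have := normc_ge0 (c * a + b); have := normc_ge0 c; have := normc_ge0 a; have := normc_ge0 b.
move: (normc (c * a + b)) (normc c) (normc a) (normc b) => u x y z z0 y0 x0 u0 uxy.
have h1 : u ^+ 2 <= (x * y + z) ^+ 2 by rewrite ler_pXn2r ?nnegrE ?addr_ge0 ?mulr_ge0.
have h2 := sqr_ge0 (x * y - z).
nra.
Qed.

Lemma tsqnorm_comb_le p n (c : R[i]) (g h : tensor R d n) : (forall k l, 0 <= p k l) ->
  (tsqnorm p (fun t => (c * g t + h t)%R) <=
   (2 * normc c ^+ 2)%:E * tsqnorm p g + 2%:E * tsqnorm p h)%E.
Proof.
move=> p0.
pose P (t : n.-tuple (idx d)) := \prod_(i <- t) p i.2.1 i.2.2.
have P0 t : 0 <= P t by apply: prodr_ge0.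
have gh0 (f : tensor R d n) t : (0 <= (P t * normc (f t) ^+ 2)%:E)%E.
  by rewrite lee_fin mulr_ge0 ?sqr_ge0.
have c0 : 0 <= 2 * normc c ^+ 2 by rewrite mulr_ge0 ?sqr_ge0.
apply: (@le_trans _ _ (\esum_(t in [set: n.-tuple (idx d)])
   ((2 * normc c ^+ 2)%:E * (P t * normc (g t) ^+ 2)%:E + 2%:E * (P t * normc (h t) ^+ 2)%:E))%E).
  apply: le_esum => t _; rewrite -!EFinM -EFinD lee_fin -/(P t).
  have := ler_wpM2l (P0 t) (normc_comb_sqr c (g t) (h t)).
  by move=> /le_trans; apply; rewrite le_eqVlt; apply/orP; left; apply/eqP; ring.
rewrite esumD; last 2 first.
- by move=> t _; rewrite mule_ge0 ?gh0// lee_fin.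
- by move=> t _; rewrite mule_ge0 ?gh0// lee_fin.
by apply: leeD; apply: le_esumZl => // t; exact: gh0.
Qed.

(** The weighted norm is multiplicative on tensor powers; [M] bounds that of [F]. *)
Lemma tsqnorm_tpow_le p F (M : R) (c : R[i]) n : (forall k l, 0 <= p k l) ->
  (\esum_(i in [set: idx d]) (p i.2.1 i.2.2 * normc (entry (testM_dual F) i) ^+ 2)%:E <= M%:E)%E ->
  (tsqnorm p (fun t : n.-tuple (idx d) => (c * tpow F t)%R) <= (normc c ^+ 2 * M ^+ n)%:E)%E.
Proof.
move=> p0 FM.
pose w (i : idx d) := p i.2.1 i.2.2 * normc (entry (testM_dual F) i) ^+ 2.
have w0 i : 0 <= w i by rewrite mulr_ge0// sqr_ge0.
have E (t : n.-tuple (idx d)) :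
   ((\prod_(i <- t) p i.2.1 i.2.2) * normc (c * tpow F t) ^+ 2)%:E =
   ((normc c ^+ 2)%:E * (\prod_(i <- t) w i)%:E)%E.
  rewrite normcM normc_prod exprMn -EFinM; congr EFin.
  by rewrite mulrCA -prodrXl -big_split.
rewrite /tsqnorm; under eq_esum do rewrite E.
apply: (le_trans (le_esumZl _ _ _)) => [|t|]; rewrite ?sqr_ge0 ?lee_fin ?prodr_ge0//.
by rewrite [leRHS]EFinM lee_wpmul2l ?lee_fin ?sqr_ge0//; exact: esum_tuple_prod_le.
Qed.

Lemma esum_finite_support (I : choiceType) (w : I -> R) : (forall i, 0 <= w i) ->
  finite_set [set i | w i != 0] ->
  exists M : R, (\esum_(i in [set: I]) (w i)%:E <= M%:E)%E.
Proof.
move=> w0 /finite_seqP[s sE].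
exists (\sum_(i <- undup s) w i); apply: esum_le_ub => X [finX _].
rewrite fsbig_finite// sumEFin lee_fin.
rewrite (bigID (fun i => i \in s))/= [X in _ + X]big1 ?addr0.
  rewrite -big_filter; apply: (@le_trans _ _ (\sum_(i <- undup s | i \in fset_set X) w i)).
    rewrite -[leRHS]big_filter le_eqVlt; apply/orP; left; apply/eqP; apply: perm_big.
    apply: uniq_perm; rewrite ?filter_uniq ?undup_uniq ?fset_uniq//.
    by move=> i; rewrite !mem_filter mem_undup andbC.
  by rewrite [leRHS](bigID (fun i => i \in fset_set X))/= lerDl sumr_ge0.
move=> i is_; apply/eqP/negPn/negP => wi; move: is_; apply/negP; rewrite negbK.
by have : [set` s] i by rewrite -sE.
Qed.

Lemma entry_esum_finite p F : (forall k l, 0 <= p k l) ->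
  exists M : R,
  (\esum_(i in [set: idx d]) (p i.2.1 i.2.2 * normc (entry (testM_dual F) i) ^+ 2)%:E <= M%:E)%E.
Proof.
move=> p0; apply: esum_finite_support => [i|]; first by rewrite mulr_ge0// sqr_ge0.
apply: sub_finite_set (entry_support_finite F) => i /=.
by apply: contra_neq => ->; rewrite normc0 expr0n mulr0.
Qed.

Lemma finite_tsqnorm1 n (g : tensor R d n) : finite_tensor g -> (tsqnorm1 g < +oo)%E.
Proof.
move=> fg.
pose w (t : n.-tuple (idx d)) : R := (\prod_(i <- t) 1) * normc (g t) ^+ 2.
have w0 t : 0 <= w t by rewrite mulr_ge0 ?sqr_ge0// prodr_ge0.
have [|M gM] := esum_finite_support w0; last by apply: le_lt_trans gM _; exact: ltry.
apply: sub_finite_set fg => t /=.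
by apply: contra_neq => gt0; rewrite /w gt0 normc0 expr0n mulr0.
Qed.

End Tensors.

(** * Wick powers and chaos expansions *)

Section ComplexExponential.
Variable R : realType.

Lemma cexpR (x : R) : cexp x%:C = (expR x)%:C.
Proof. by rewrite /cexp/= cos0 sin0 mulr1. Qed.

Lemma cexpi (t : R) : cexp ('i * t%:C) = cos t +i* sin t.
Proof.
have -> : 'i * t%:C = 0 +i* t by simpc.
by rewrite /cexp/= expR0 mul1r.
Qed.

Lemma normc_sqr (z : R[i]) : normc z ^+ 2 = complex.Re z ^+ 2 + complex.Im z ^+ 2.
Proof. by case: z => x y /=; rewrite sqr_sqrtr// addr_ge0// sqr_ge0. Qed.

End ComplexExponential.

Section WickPowers.
Variables (R : realType) (d : nat) (W : dualM R d -> forall n, tensor R d n).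
Arguments W : clear implicits.
Hypothesis WP : wick_monomials W.

(** Both sides are Taylor coefficients at [0] of [s |-> exp (<x, s F> - |s F|^2 / 2)]
    for real [s], on one side by the generating function of Wick powers. *)
Lemma wick_hermite x (F : testM R d) n :
  tpair (W x n) (@tpow R d F n) = (n`!%:R * hermite_coef (re_pairing F x) (sqnorm F) n)%:C.
Proof.
pose X := re_pairing F x; pose v := sqnorm F.
pose c k := (k`!%:R)^-1 * tpair (W x k) (@tpow R d F k) - (hermite_coef X v k)%:C.
have c0 (s : R) : ccvg (fun N => \sum_(0 <= k < N) c k * s%:C ^+ k) 0.
  have h1 : ccvg (fun N => \sum_(0 <= k < N) (k`!%:R)^-1 * tpair (W x k) (@tpow R d F k) * s%:C ^+ k)
      (expR (s * X - s ^+ 2 * v / 2))%:C.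
    have /cvg_ccvg := WP.2 x (tscale s F).
    rewrite pairing_tscale pairingE sqnorm_tscale -rmorphM -rmorphB cexpR -/X -/v.
    congr (ccvg _ _); apply/funext => N; apply: eq_bigr => k _.
    rewrite -mulrA; congr (_ * _); rewrite mulrC -tpairZ; congr tpair.
    by apply/funext => t; exact: tpow_tscale.
  have h2 := @hermite_generating R X v s%:C (expR (s * X))%:C (s ^+ 2).
  have {h2} := h2 _ _; rewrite -!rmorphM -rmorphXn -expRD => h2.
  have {}h2 := h2 erefl (@ccvg_expR_series R (s * X)).
  have := ccvgD h1 (ccvgMr (-1) h2); rewrite mulN1r subrr.
  congr (ccvg _ _); apply/funext => N.
  rewrite mulr_sumr -big_split; apply: eq_bigr => k _ /=.
  by rewrite /c ?rmorphXn/=; ring.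
have ck k : c k = 0.
  have part (f : R[i] -> R) : f 0 = 0 -> {morph f : z z' / z + z'} ->
      (forall (z : R[i]) (r : R), f (z * r%:C) = f z * r) ->
      (forall z, `|f z| <= normc z) -> forall k, f (c k) = 0.
    move=> f0 fD fZ fle; apply: power_series_eq0 => s.
    apply/norm_cvg0P; apply: (squeeze_cvgr (f := cst 0) (h := fun N => normc (\sum_(0 <= k < N) c k * s%:C ^+ k - 0))).
    - apply: nearW => N; rewrite normr_ge0 subr0 (le_trans _ (fle _))//.
      rewrite (big_morph f fD f0) le_eqVlt; apply/orP; left; apply/eqP; congr `|_|.
      by apply: eq_bigr => j _; rewrite -rmorphXn fZ.
    - exact: cvg_cst.
    - exact: c0.
  apply/eqP; rewrite eq_complex/=; apply/andP; split; apply/eqP.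
    by apply: (part (@complex.Re R)) => // [[? ?] [? ?]|[a b] r|] //; [simpc|exact: Re_le_normc].
  by apply: (part (@complex.Im R)) => // [[? ?] [? ?]|[a b] r|] //; [simpc|exact: Im_le_normc].
have /eqP := ck n; rewrite /c subr_eq0 => /eqP.
have n0 : (n`!%:R : R[i]) != 0 by rewrite pnatr_eq0 -lt0n fact_gt0.
move=> /(congr1 (fun z => n`!%:R * z)); rewrite mulrA mulfV// mul1r => ->.
by rewrite rmorphM/= rmorph_nat.
Qed.

End WickPowers.

Section ChaosExpansions.
Variables (R : realType) (d : nat) (gauss : probability (dualMs R d) R).
Variable (W : dualM R d -> forall n, tensor R d n).
Arguments W : clear implicits.
Hypotheses (gaussP : standard_gaussian gauss) (WP : wick_monomials W).
Implicit Types (F G : testM R d).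

Lemma measurable_re_pairing F : measurable_fun [set: dualMs R d] (re_pairing F).
Proof.
move=> _ B mB; rewrite setTI; apply: sub_sigma_algebra.
by exists F, B.
Qed.

Lemma gaussian_moment F (c : R) :
  (\int[gauss]_x (expR (c * re_pairing F x))%:E < +oo)%E.
Proof.
have char s : cintegral gauss (fun x => cexp ('i * (s * re_pairing F x)%:C)) =
    (expR (- (s ^+ 2 * sqnorm F / 2)))%:C.
  have := gaussP (tscale s F); rewrite sqnorm_tscale -rmorphN cexpR => <-.
  by congr cintegral; apply/funext => x; rewrite pairing_tscale pairingE rmorphM.
have E s : cintegral gauss (fun x => cexp ('i * (s * re_pairing F x)%:C)) =
    (\int[gauss]_x cos (s * re_pairing F x)) +i* (\int[gauss]_x sin (s * re_pairing F x)).
  by rewrite /cintegral; congr (_ +i* _); apply: eq_Rintegral => x _; rewrite cexpi.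
have {}char s := etrans (esym (E s)) (char s).
by apply: (gaussian_expR_moment (measurable_re_pairing F) (sqnorm_ge0 F)) => s;
  case: (char s).
Qed.

Lemma measurable_hermite F n :
  measurable_fun [set: dualMs R d] (fun x => hermite_coef (re_pairing F x) (sqnorm F) n).
Proof.
rewrite /hermite_coef; apply: measurable_sum => j.
apply: measurable_funM => //; apply: measurable_funM => //.
by apply: measurable_funX; exact: measurable_re_pairing.
Qed.

Lemma measurable_normc_sqr (f : dualMs R d -> R[i]) :
  measurable_fun [set: dualMs R d] (fun x => complex.Re (f x)) ->
  measurable_fun [set: dualMs R d] (fun x => complex.Im (f x)) ->
  measurable_fun [set: dualMs R d] (fun x => (normc (f x) ^+ 2)%:E).
Proof.
move=> mr mi; apply/measurable_EFinP; under eq_fun do rewrite normc_sqr.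
by apply: measurable_funD; apply: measurable_funX.
Qed.

Lemma finite_pairing_measurable (c : nat -> R[i]) F N :
  let S x := \sum_(0 <= n < N) c n * tpair (W x n) (@tpow R d F n) in
  measurable_fun [set: dualMs R d] (fun x => complex.Re (S x)) /\
  measurable_fun [set: dualMs R d] (fun x => complex.Im (S x)).
Proof.
move=> S.
have E x : S x = (\sum_(0 <= n < N) complex.Re (c n) * (n`!%:R * hermite_coef (re_pairing F x) (sqnorm F) n))
   +i* (\sum_(0 <= n < N) complex.Im (c n) * (n`!%:R * hermite_coef (re_pairing F x) (sqnorm F) n)).
  rewrite /S; elim: N {S} => [|N IH]; first by rewrite !big_nil.
  by rewrite !big_nat_recr//= IH wick_hermite//; case: (c N) => a b; simpc.
split.
  under eq_fun do rewrite E/=; apply: measurable_sum => n.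
  by do 2 apply: measurable_funM => //; exact: measurable_hermite.
under eq_fun do rewrite E/=; apply: measurable_sum => n.
by do 2 apply: measurable_funM => //; exact: measurable_hermite.
Qed.

(** For finite kernels [<:x^n:, K n>] is defined pointwise.  Asking moreover that
    it be square integrable, hence measurable, makes these expansions a vector
    space. *)
Definition finite_chaos (f : dualM R d -> R[i]) (K : forall n, tensor R d n) :=
  [/\ cL2 gauss f,
      forall n, [/\ symmetric_tensor (K n), finite_tensor (K n) &
                   cL2 gauss (fun x => tpair (W x n) (K n))] &
      cL2_cvg gauss (fun N x => \sum_(0 <= n < N) tpair (W x n) (K n)) f].

Lemma finite_chaos_chaos f K : finite_chaos f K -> chaos gauss W f K.
Proof.
move=> [f2 KP Kf]; split => //.
  by move=> n; have [sK fK _] := KP n; split => //; exact: finite_tsqnorm1.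
exists (fun n x => tpair (W x n) (K n)); split=> // n.
have [sK fK K2] := KP n; split => //; exists (fun=> K n); split => //.
- rewrite (_ : (fun=> _) = cst 0%E); first exact: cvg_cst.
  apply/funext => N; rewrite /tsqnorm1 /tsqnorm esum1// => t _.
  by rewrite subrr normc0 expr0n mulr0.
- rewrite /cL2_cvg (_ : (fun=> _) = cst 0%E); first exact: cvg_cst.
  apply/funext => N; apply: integral0_eq => x _.
  by rewrite subrr normc0 expr0n.
Qed.

(** Expansions in the Wick powers of one [F], with coefficients of size
    [C r^n / n!].  By the bound on Hermite polynomials at radius [2 r], the partial
    sums are dominated by a multiple of [exp (2 r |<x, F>|)], which is square
    integrable because [<x, F>] has all exponential moments.  So convergence at
    every [x] implies convergence in [L^2]. *)
Section Series.
Variables (F : testM R d) (c : nat -> R[i]) (C r : R) (f : dualM R d -> R[i]).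
Hypotheses (C0 : 0 <= C) (r0 : 0 <= r).
Hypothesis cC : forall n, normc (c n) * n`!%:R <= C * r ^+ n.
Hypothesis cf : forall x,
  ccvg (fun N => \sum_(0 <= n < N) c n * tpair (W x n) (@tpow R d F n)) (f x).

Let K n : tensor R d n := fun t => c n * tpow F t.
Arguments K : clear implicits.
Let w n x := tpair (W x n) (@K n).
Let S N x := \sum_(0 <= n < N) w n x.
(* The sum of the bounds on the terms is [2 B x]; the factor [2] of [2 r] leaves a
   geometric factor [2^-n] in the [n]-th one. *)
Let B x := C * (expR (2 * r * `|re_pairing F x|) * expR ((2 * r) ^+ 2 * sqnorm F / 2)).

Let wE n x : w n x = c n * tpair (W x n) (@tpow R d F n).
Proof. exact: tpairZ. Qed.

Let B0 x : 0 <= B x.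
Proof. by rewrite !mulr_ge0 ?expR_ge0. Qed.

Let w_le n x : normc (w n x) <= B x * (1 / 2) ^+ n.
Proof.
rewrite wE wick_hermite// normcM normcR normrM normr_nat mulrA.
have hb := @hermite_coef_bound R (re_pairing F x) (sqnorm F) (2 * r) n.
have {}hb := hb (mulr_ge0 (ler0n _ _) r0) (sqnorm_ge0 F).
have h2 : 0 <= (1 / 2 : R) ^+ n by rewrite exprn_ge0.
apply: (@le_trans _ _ (C * r ^+ n * `|hermite_coef (re_pairing F x) (sqnorm F) n|)).
  exact: ler_wpM2r.
have -> : r ^+ n = (2 * r) ^+ n * (1 / 2) ^+ n by rewrite -exprMn; congr (_ ^+ _); field.
rewrite /B -expRD.
set e := expR _ in hb *; set h := `|_| in hb *; set q := (2 * r) ^+ n in hb *.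
set p := (1 / 2) ^+ n in h2 *.
have -> : C * (q * p) * h = C * (h * q) * p by ring.
by rewrite ler_wpM2r// ler_wpM2l.
Qed.

Let S_le N x : normc (S N x) <= 2 * B x.
Proof.
have E n : \sum_(0 <= k < n) B x * (1 / 2) ^+ k = 2 * B x * (1 - (1 / 2) ^+ n).
  elim: n => [|n IH]; first by rewrite big_nil expr0 subrr mulr0.
  by rewrite big_nat_recr//= IH exprS; field.
rewrite (le_trans (normc_sum _ _))//.
apply: (@le_trans _ _ (\sum_(0 <= k < N) B x * (1 / 2) ^+ k)); first exact: ler_sum_nat.
rewrite E ler_piMr ?mulr_ge0// lerBlDr lerDl exprn_ge0//.
Qed.

Let f_le x : normc (f x) <= 2 * B x.
Proof.
apply/ler_addgt0Pr => e e0.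
have /cvgrPdist_lt/(_ _ e0)[N _ /(_ N (leqnn N))]/= := cf x.
rewrite sub0r normrN ger0_norm ?normc_ge0// => fN.
have -> : f x = S N x + - (S N x - f x) by ring.
rewrite (le_trans (le_normcD _ _))// normcN lerD//.
rewrite le_eqVlt; apply/orP; right; apply: le_lt_trans fN.
by rewrite le_eqVlt; apply/orP; left; apply/eqP; congr normc; congr (_ - _);
  apply: eq_bigr => k _; rewrite wE.
Qed.

Let S_cvg x : ccvg (S ^~ x) (f x).
Proof.
have := cf x; congr (ccvg _ _); apply/funext => N.
by apply: eq_bigr => k _; rewrite wE.
Qed.

Let measurable_S N :
  measurable_fun [set: dualMs R d] (fun x => complex.Re (S N x)) /\
  measurable_fun [set: dualMs R d] (fun x => complex.Im (S N x)).
Proof.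
have -> : S N = (fun x => \sum_(0 <= n < N) c n * tpair (W x n) (@tpow R d F n)).
  by apply/funext => x; apply: eq_bigr => k _; rewrite wE.
exact: finite_pairing_measurable.
Qed.

Let measurable_f :
  measurable_fun [set: dualMs R d] (fun x => complex.Re (f x)) /\
  measurable_fun [set: dualMs R d] (fun x => complex.Im (f x)).
Proof.
split.
  apply: (@measurable_fun_cvg _ _ _ _ (fun N (x : dualMs R d) => complex.Re (S N x))).
    by move=> N; exact: (measurable_S N).1.
  by move=> x _; have /ccvgE[] := S_cvg x.
apply: (@measurable_fun_cvg _ _ _ _ (fun N (x : dualMs R d) => complex.Im (S N x))).
  by move=> N; exact: (measurable_S N).2.
by move=> x _; have /ccvgE[] := S_cvg x.
Qed.

Let D (x : dualMs R d) : R := (4 * B x) ^+ 2.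

Let D_integrable : gauss.-integrable [set: dualMs R d] (EFin \o D).
Proof.
pose k := (4 * C * expR ((2 * r) ^+ 2 * sqnorm F / 2)) ^+ 2.
have DE x : D x = k * expR (4 * r * `|re_pairing F x|).
  have -> : expR (4 * r * `|re_pairing F x|) = expR (2 * r * `|re_pairing F x|) ^+ 2.
    by rewrite -expRM_natl; congr expR; ring.
  by rewrite /D /B /k; ring.
have mD : measurable_fun [set: dualMs R d] D.
  have -> : D = (fun x => k * expR (4 * r * `|re_pairing F x|)) by exact/funext.
  apply: measurable_funM => //; apply: measurableT_comp => //.
  by apply: measurable_funM => //; apply: measurableT_comp => //; exact: measurable_re_pairing.
apply/integrableP; split; first exact/measurable_EFinP.
have k0 : 0 <= k by exact: sqr_ge0.
pose g (a : R) (x : dualMs R d) := (k%:E * (expR (a * re_pairing F x))%:E)%E.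
have me a : measurable_fun [set: dualMs R d] (fun x => (expR (a * re_pairing F x))%:E).
  apply/measurable_EFinP; apply: measurableT_comp => //.
  by apply: measurable_funM => //; exact: measurable_re_pairing.
have mg a : measurable_fun [set: dualMs R d] (g a).
  by apply: emeasurable_funM => //; exact: me.
have g0 a x : (0 <= g a x)%E by rewrite mule_ge0// lee_fin ?expR_ge0.
have gy a : (\int[gauss]_x g a x < +oo)%E.
  rewrite ge0_integralZl//.
  by apply: lte_mul_pinfty => //; exact: gaussian_moment.
apply: (@le_lt_trans _ _ (\int[gauss]_x (g (4 * r)%R x + g (- (4 * r))%R x))%E); last first.
  by rewrite ge0_integralD//; exact: lte_add_pinfty.
apply: ge0_le_integral => //.
- by apply/measurableT_comp => //; exact/measurable_EFinP.
- by apply: emeasurable_funD.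
move=> x _ /=; rewrite lee_fin ger0_norm ?sqr_ge0// DE -mulrDr ler_wpM2l//.
have [y0|y0] := leP 0 (re_pairing F x).
  by rewrite (ger0_norm y0) lerDl expR_ge0.
by rewrite (ltr0_norm y0) mulrN mulNr lerDr expR_ge0.
Qed.

Let D_bound (u : dualM R d -> R[i]) x : normc (u x) <= 4 * B x -> normc (u x) ^+ 2 <= D x.
Proof.
by move=> uB; rewrite ler_pXn2r// nnegrE ?normc_ge0// mulr_ge0.
Qed.

Let cL2_dominated (u : dualM R d -> R[i]) :
  measurable_fun [set: dualMs R d] (fun x => complex.Re (u x)) /\
  measurable_fun [set: dualMs R d] (fun x => complex.Im (u x)) ->
  (forall x, normc (u x) <= 4 * B x) -> cL2 gauss u.
Proof.
move=> [mr mi] uB; split => //.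
have /integrableP[mD] := D_integrable; apply: le_lt_trans.
apply: ge0_le_integral => //.
- by move=> x _; rewrite lee_fin sqr_ge0.
- exact: measurable_normc_sqr.
- exact: measurableT_comp.
- by move=> x _ /=; rewrite lee_fin ger0_norm ?sqr_ge0// D_bound.
Qed.

Let cL2_term n : cL2 gauss (w n).
Proof.
apply: cL2_dominated.
  have -> : w n = (fun x => \sum_(0 <= k < n.+1) (if k == n then c k else 0) * tpair (W x k) (@tpow R d F k)).
    apply/funext => x; rewrite big_nat_recr//= eqxx wE big_nat_cond big1 ?add0r// => k.
    by rewrite andbT => /andP[_ kn]; rewrite ltn_eqF// mul0r.
  exact: finite_pairing_measurable.
move=> x; apply: (le_trans (w_le n x)).
apply: (@le_trans _ _ (B x * 1)); last by rewrite mulr1; have := B0 x; lra.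
by rewrite ler_wpM2l// exprn_ile1//; lra.
Qed.

Lemma finite_chaos_series : finite_chaos f K.
Proof.
split.
- apply: cL2_dominated; first exact: measurable_f.
  by move=> x; apply: (le_trans (f_le x)); have := B0 x; lra.
- move=> n; split; last exact: cL2_term.
    by move=> t u tu; rewrite /K (tpow_symmetric F tu).
  apply: sub_finite_set (tpow_finite F n) => t /=.
  by apply: contra_neq => t0; rewrite /K t0 mulr0.
rewrite /cL2_cvg -/S.
have diff_le N x : normc (S N x - f x) <= 4 * B x.
  rewrite (le_trans (le_normcD _ _))// normcN.
  by have := S_le N x; have := f_le x; lra.
rewrite -[X in _ --> X](integral0 gauss [set: dualMs R d]).
apply: (@dominated_cvg _ _ _ gauss _ measurableT _ (cst 0%E) (EFin \o D)) => //.
- move=> N; apply: (measurable_normc_sqr (f := fun x => S N x - f x)).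
    have E x : complex.Re (S N x - f x) = complex.Re (S N x) - complex.Re (f x).
      by case: (S N x) => ? ?; case: (f x).
    under eq_fun do rewrite E.
    by apply: measurable_funB; [exact: (measurable_S N).1|exact: measurable_f.1].
  have E x : complex.Im (S N x - f x) = complex.Im (S N x) - complex.Im (f x).
    by case: (S N x) => ? ?; case: (f x).
  under eq_fun do rewrite E.
  by apply: measurable_funB; [exact: (measurable_S N).2|exact: measurable_f.2].
- move=> x _; apply/fine_cvgP; split; first exact: nearW.
  rewrite (_ : _ \o _ = (fun N => normc (S N x - f x) * normc (S N x - f x))); last first.
    by apply/funext => N /=; rewrite expr2.
  by rewrite -[X in _ --> X](mulr0 0); apply: cvgM; exact: S_cvg.
- by move=> N x _ /=; rewrite lee_fin ger0_norm ?sqr_ge0// (D_bound (u := fun x => S N x - f x)).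
Qed.

(** The norm costs one factorial and the squared coefficients supply two, which
    leaves an exponential series. *)
Lemma kernel_sqnorm_series p q (M : R) : weight p ->
  (\esum_(i in [set: idx d]) (p i.2.1 i.2.2 * normc (entry (testM_dual F) i) ^+ 2)%:E <= M%:E)%E ->
  (kernel_sqnorm p q K <= (C ^+ 2 * expR (r ^+ 2 * 2 ^+ q * M))%:E)%E.
Proof.
move=> wp FM.
have p0 k l : 0 <= p k l by exact: weight_ge0.
have M0 : 0 <= M.
  rewrite -lee_fin; apply: le_trans FM; apply: esum_ge0 => i _.
  by rewrite lee_fin mulr_ge0// sqr_ge0.
set X := r ^+ 2 * 2 ^+ q * M.
have X0 : 0 <= X by rewrite !mulr_ge0// ?sqr_ge0// exprn_ge0.
have term n : ((n`! * 2 ^ (n * q))%:R%:E * tsqnorm p (K n) <=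
    (C ^+ 2 * (X ^+ n / n`!%:R))%:E)%E.
  apply: (@le_trans _ _ ((n`! * 2 ^ (n * q))%:R%:E * (normc (c n) ^+ 2 * M ^+ n)%:E)%E).
    by apply: lee_wpmul2l; [rewrite lee_fin|exact: tsqnorm_tpow_le].
  rewrite -EFinM lee_fin natrM natrX exprM.
  have n0 : 0 < n`!%:R :> R by rewrite ltr0n fact_gt0.
  have cn : normc (c n) ^+ 2 <= (C * r ^+ n / n`!%:R) ^+ 2.
    by rewrite ler_pXn2r ?nnegrE ?normc_ge0 ?divr_ge0 ?mulr_ge0 ?exprn_ge0// ler_pdivlMr.
  apply: (@le_trans _ _ (n`!%:R * 2 ^+ n ^+ q * ((C * r ^+ n / n`!%:R) ^+ 2 * M ^+ n))).
    by rewrite ler_wpM2l ?mulr_ge0 ?exprn_ge0 ?ler0n// ler_wpM2r// exprn_ge0.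
  rewrite le_eqVlt; apply/orP; left; apply/eqP.
  have XE : X ^+ n = (r ^+ n) ^+ 2 * 2 ^+ n ^+ q * M ^+ n.
    by rewrite (exprMn n (r ^+ 2 * 2 ^+ q) M) (exprMn n (r ^+ 2) (2 ^+ q)) (exprAC r 2 n) (exprAC 2 q n).
  by rewrite XE; field; exact: lt0r_neq0.
apply: lime_le.
  by apply: is_cvg_nneseries => n _ _; rewrite mule_ge0 ?lee_fin// tsqnorm_ge0.
apply: nearW => N.
apply: (@le_trans _ _ (\sum_(0 <= n < N) (C ^+ 2 * (X ^+ n / n`!%:R))%:E)%E).
  by apply: lee_sum => n _; exact: term.
rewrite sumEFin lee_fin -mulr_sumr ler_wpM2l ?sqr_ge0//.
exact: expR_partial_le.
Qed.

Lemma hida_sqnorm_series p q (M : R) : weight p ->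
  (\esum_(i in [set: idx d]) (p i.2.1 i.2.2 * normc (entry (testM_dual F) i) ^+ 2)%:E <= M%:E)%E ->
  (hida_sqnorm gauss W p q f <= (C ^+ 2 * expR (r ^+ 2 * 2 ^+ q * M))%:E)%E.
Proof.
move=> wp FM; apply: le_trans (kernel_sqnorm_series q wp FM).
by apply: ereal_inf_lbound; exists K => //; exact/finite_chaos_chaos/finite_chaos_series.
Qed.

End Series.
End ChaosExpansions.

(** * The space of expansions with finite kernels *)

Section ExpansionSpace.
Variables (R : realType) (d : nat) (gauss : probability (dualMs R d) R).
Variable (W : dualM R d -> forall n, tensor R d n).
Arguments W : clear implicits.
Implicit Types (f g : dualM R d -> R[i]) (a : R[i]).

Let DD := [set: dualMs R d].

Lemma measurable_comb a f g :
  measurable_fun DD (fun x => complex.Re (f x)) ->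
  measurable_fun DD (fun x => complex.Im (f x)) ->
  measurable_fun DD (fun x => complex.Re (g x)) ->
  measurable_fun DD (fun x => complex.Im (g x)) ->
  measurable_fun DD (fun x => complex.Re (a * f x + g x)) /\
  measurable_fun DD (fun x => complex.Im (a * f x + g x)).
Proof.
move=> fr fi gr gi; case: a => u v.
have Er x : complex.Re ((u +i* v) * f x + g x) =
    (u * complex.Re (f x) + (- v) * complex.Im (f x)) + complex.Re (g x).
  by case: (f x) => ? ?; case: (g x) => ? ?; simpc.
have Ei x : complex.Im ((u +i* v) * f x + g x) =
    (u * complex.Im (f x) + v * complex.Re (f x)) + complex.Im (g x).
  by case: (f x) => ? ?; case: (g x) => ? ?; simpc.
split.
  under eq_fun do rewrite Er.
  by apply: measurable_funD => //; apply: measurable_funD; apply: measurable_funM.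
under eq_fun do rewrite Ei.
by apply: measurable_funD => //; apply: measurable_funD; apply: measurable_funM.
Qed.

Lemma integral_comb_le a f g :
  measurable_fun DD (fun x => complex.Re (f x)) ->
  measurable_fun DD (fun x => complex.Im (f x)) ->
  measurable_fun DD (fun x => complex.Re (g x)) ->
  measurable_fun DD (fun x => complex.Im (g x)) ->
  (\int[gauss]_x (normc (a * f x + g x) ^+ 2)%:E <=
   (2 * normc a ^+ 2)%:E * \int[gauss]_x (normc (f x) ^+ 2)%:E +
   2%:E * \int[gauss]_x (normc (g x) ^+ 2)%:E)%E.
Proof.
move=> fr fi gr gi.
have [cr ci] := measurable_comb a fr fi gr gi.
have mf := measurable_normc_sqr fr fi; have mg := measurable_normc_sqr gr gi.
have a0 : 0 <= 2 * normc a ^+ 2 by rewrite mulr_ge0 ?sqr_ge0.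
have n0 h (x : dualMs R d) : (0 <= (normc (h x : R[i]) ^+ 2)%:E)%E by rewrite lee_fin sqr_ge0.
rewrite -!ge0_integralZl//.
have mf' : measurable_fun DD (fun x => (2 * normc a ^+ 2)%:E * (normc (f x) ^+ 2)%:E)%E.
  exact: emeasurable_funM.
have mg' : measurable_fun DD (fun x => 2%:E * (normc (g x) ^+ 2)%:E)%E.
  exact: emeasurable_funM.
rewrite -ge0_integralD//; last 2 first.
- by move=> x _; rewrite mule_ge0 ?n0 ?lee_fin.
- by move=> x _; rewrite mule_ge0 ?n0 ?lee_fin.
apply: ge0_le_integral => //.
- by move=> x _; exact: (n0 (fun x => a * f x + g x)).
- exact: (measurable_normc_sqr (f := fun x => a * f x + g x) cr ci).
- exact: emeasurable_funD.
- by move=> x _; rewrite -!EFinM -EFinD lee_fin normc_comb_sqr.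
Qed.

Lemma cL2_comb a f g : cL2 gauss f -> cL2 gauss g -> cL2 gauss (fun x => a * f x + g x).
Proof.
move=> [fr fi f2] [gr gi g2].
have [cr ci] := measurable_comb a fr fi gr gi; split => //.
apply: le_lt_trans (integral_comb_le a fr fi gr gi) _.
by apply: lte_add_pinfty; apply: lte_mul_pinfty => //; rewrite lee_fin mulr_ge0 ?sqr_ge0.
Qed.

Lemma cL2_sum (N : nat) (h : nat -> dualM R d -> R[i]) : (forall n, cL2 gauss (h n)) ->
  cL2 gauss (fun x => \sum_(0 <= n < N) h n x).
Proof.
move=> h2; elim: N => [|N IH].
  under eq_fun do rewrite big_nil.
  split; [exact: measurable_cst..|].
  by rewrite integral0_eq ?ltry// => x _; rewrite normc0 expr0n.
under eq_fun do rewrite big_nat_recr//= -[X in X + _]mul1r.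
exact: cL2_comb.
Qed.

Lemma cL2_cvg_comb a (f_ g_ : nat -> dualM R d -> R[i]) f g :
  (forall N, cL2 gauss (f_ N)) -> (forall N, cL2 gauss (g_ N)) ->
  cL2 gauss f -> cL2 gauss g -> cL2_cvg gauss f_ f -> cL2_cvg gauss g_ g ->
  cL2_cvg gauss (fun N x => a * f_ N x + g_ N x) (fun x => a * f x + g x).
Proof.
move=> fN2 gN2 f2 g2 ff gg; rewrite /cL2_cvg.
have diff (u v : dualM R d -> R[i]) : cL2 gauss u -> cL2 gauss v ->
    cL2 gauss (fun x => u x - v x).
  move=> u2 v2; have := cL2_comb (-1) v2 u2.
  by congr cL2; apply/funext => x; rewrite mulN1r addrC.
apply: (@squeeze_cvge _ _ _ _ (cst 0%E) _ (fun N =>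
   (2 * normc a ^+ 2)%:E * \int[gauss]_x (normc (f_ N x - f x) ^+ 2)%:E +
   2%:E * \int[gauss]_x (normc (g_ N x - g x) ^+ 2)%:E)%E).
- apply: nearW => N; apply/andP; split.
    by apply: integral_ge0 => x _; rewrite lee_fin sqr_ge0.
  have [ur ui _] := diff _ _ (fN2 N) f2; have [vr vi _] := diff _ _ (gN2 N) g2.
  apply: le_trans (integral_comb_le a ur ui vr vi).
  rewrite le_eqVlt; apply/orP; left; apply/eqP; apply: eq_integral => x _.
  by congr (_ ^+ 2)%:E; congr normc; ring.
- exact: cvg_cst.
- rewrite (_ : 0%E = (2 * normc a ^+ 2)%:E * 0 + 2%:E * 0)%E; last by rewrite !mule0 adde0.
  by apply: cvgeD => //; apply: cvgeZl.
Qed.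

Lemma finite_chaos_comb a f g K L :
  finite_chaos gauss W f K -> finite_chaos gauss W g L ->
  finite_chaos gauss W (fun x => a * f x + g x) (fun n t => a * K n t + L n t).
Proof.
move=> [f2 fK fN] [g2 gL gN].
have E n x : tpair (W x n) (fun t => a * K n t + L n t) =
    a * tpair (W x n) (K n) + tpair (W x n) (L n).
  have [_ finK _] := fK n; have [_ finL _] := gL n.
  rewrite tpairD ?tpairZ//.
  by apply: sub_finite_set finK => t /=; apply: contra_neq => ->; rewrite mulr0.
split.
- exact: cL2_comb.
- move=> n; have [sK finK K2] := fK n; have [sL finL L2] := gL n; split.
  + by move=> t u tu; rewrite (sK _ _ tu) (sL _ _ tu).
  + apply: (sub_finite_set (B := [set t | K n t != 0] `|` [set t | L n t != 0])).
      move=> t /= h; apply: contrapT => /not_orP[/negP/negPn/eqP Kt /negP/negPn/eqP Lt].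
      by move: h; rewrite Kt Lt mulr0 addr0 eqxx.
    by rewrite finite_setU.
  + by under eq_fun do rewrite E; exact: cL2_comb.
have -> : (fun (N : nat) x => \sum_(0 <= n < N) tpair (W x n) (fun t => a * K n t + L n t)) =
  (fun N x => a * (\sum_(0 <= n < N) tpair (W x n) (K n)) + \sum_(0 <= n < N) tpair (W x n) (L n)).
  apply/funext => N; apply/funext => x; rewrite mulr_sumr -big_split.
  by apply: eq_bigr => n _; exact: E.
apply: cL2_cvg_comb => // N; apply: cL2_sum => n.
  by have [] := fK n.
by have [] := gL n.
Qed.

(** A linear subspace of the test functions, large enough for exponentials and
    polynomials. *)
Definition finite_test f := exists2 K, finite_chaos gauss W f K &
  forall p q, weight p -> (kernel_sqnorm p q K < +oo)%E.

Lemma finite_test_hida f : finite_test f -> hida_test gauss W f.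
Proof.
move=> [K fK Kfin] p q wp; apply: le_lt_trans (Kfin p q wp).
by apply: ereal_inf_lbound; exists K => //; exact: finite_chaos_chaos.
Qed.

Lemma finite_test_comb a f g : finite_test f -> finite_test g ->
  finite_test (fun x => a * f x + g x).
Proof.
move=> [K fK Kfin] [L gL Lfin]; exists (fun n t => a * K n t + L n t).
  exact: finite_chaos_comb.
move=> p q wp.
have p0 k l : 0 <= p k l by exact: weight_ge0.
have t0 (J : forall n, tensor R d n) n : (0 <= (n`! * 2 ^ (n * q))%:R%:E * tsqnorm p (J n))%E.
  by rewrite mule_ge0 ?lee_fin// tsqnorm_ge0.
have a0 : (0 <= 2 * normc a ^+ 2)%R by rewrite mulr_ge0 ?sqr_ge0.
apply: (@le_lt_trans _ _ ((2 * normc a ^+ 2)%:E * kernel_sqnorm p q K + 2%:E * kernel_sqnorm p q L)%E).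
  apply: lime_le.
    by apply: is_cvg_nneseries => n _ _; exact: (t0 (fun n t => a * K n t + L n t)).
  apply: nearW => N.
  apply: (@le_trans _ _ (\sum_(0 <= n < N)
     ((2 * normc a ^+ 2)%:E * ((n`! * 2 ^ (n * q))%:R%:E * tsqnorm p (K n)) +
      2%:E * ((n`! * 2 ^ (n * q))%:R%:E * tsqnorm p (L n))))%E).
    apply: lee_sum => n _; rewrite muleCA [X in (_ + X)%E]muleCA.
    rewrite -ge0_muleDr ?mule_ge0 ?lee_fin ?tsqnorm_ge0//.
    by apply: lee_wpmul2l; [rewrite lee_fin|exact: tsqnorm_comb_le].
  rewrite big_split/= -!ge0_sume_distrr//.
  by apply: leeD; apply: lee_wpmul2l; rewrite ?lee_fin//; exact: nneseries_lim_ge.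
apply: lte_add_pinfty; apply: lte_mul_pinfty => //; [exact: Kfin|exact: Lfin].
Qed.

End ExpansionSpace.

(** * Exponentials and squares as test functions *)

Section TestFunctions.
Variables (R : realType) (d : nat) (gauss : probability (dualMs R d) R).
Variable (W : dualM R d -> forall n, tensor R d n).
Arguments W : clear implicits.
Hypotheses (gaussP : standard_gaussian gauss) (WP : wick_monomials W).
Implicit Types (F G : testM R d).

Lemma finite_test_series F (c : nat -> R[i]) (C r : R) f : 0 <= C -> 0 <= r ->
  (forall n, normc (c n) * n`!%:R <= C * r ^+ n) ->
  (forall x, ccvg (fun N => \sum_(0 <= n < N) c n * tpair (W x n) (@tpow R d F n)) (f x)) ->
  finite_test gauss W f.
Proof.
move=> C0 r0 cC cf; exists (fun n t => c n * tpow F t).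
  exact: finite_chaos_series cC cf.
move=> p q wp; have [M FM] := entry_esum_finite F (fun k l => weight_ge0 k l wp).
by apply: le_lt_trans (kernel_sqnorm_series C0 r0 cC q wp FM) _; exact: ltry.
Qed.

(** The coefficients of [exp (i t <x, F>)] in the Wick powers of [F], where
    [v = |F|^2]. *)
Definition exp_coef (v t : R) n : R[i] :=
  (expR (- (t ^+ 2 * v / 2)))%:C * (('i * t%:C) ^+ n / n`!%:R).

(** The expansion [<x, F>^2 = <:x^2:, F^2> + |F|^2]. *)
Definition square_coef (v : R) n : R[i] :=
  if n == 0%N then v%:C else if n == 2%N then 1 else 0.

Lemma normc_i : normc ('i : R[i]) = 1.
Proof. by rewrite /= expr0n add0r expr1n sqrtr1. Qed.

Lemma normc_natV n : normc ((n`!%:R)^-1 : R[i]) = (n`!%:R)^-1.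
Proof. by rewrite normcV -(rmorph_nat (real_complex R)) normcR normr_nat. Qed.

Lemma fact_neq0 n : (n`!%:R : R) != 0.
Proof. by rewrite pnatr_eq0 -lt0n fact_gt0. Qed.

Lemma exp_coef_normc (v t : R) n :
  normc (exp_coef v t n) * n`!%:R = expR (- (t ^+ 2 * v / 2)) * `|t| ^+ n.
Proof.
rewrite /exp_coef !normcM normcR ger0_norm ?expR_ge0// normc_natV normcX normcM normc_i mul1r normcR.
by rewrite -!mulrA mulVf ?mulr1// fact_neq0.
Qed.

Lemma exp_coef_le (v t : R) n : 0 <= v -> normc (exp_coef v t n) * n`!%:R <= 1 * `|t| ^+ n.
Proof.
move=> v0; rewrite exp_coef_normc ler_wpM2r ?exprn_ge0//.
by rewrite -[leRHS]expR0 ler_expR oppr_le0 divr_ge0// mulr_ge0// sqr_ge0.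
Qed.

Lemma wick_series_exp F t x :
  ccvg (fun N => \sum_(0 <= n < N) exp_coef (sqnorm F) t n * tpair (W x n) (@tpow R d F n))
    (cexp ('i * pairing x (tscale t F))).
Proof.
set v := sqnorm F; set X := re_pairing F x.
have h := @hermite_generating R X v ('i * t%:C) (cos (t * X) +i* sin (t * X)) (- t ^+ 2).
have {}h := h _ _.
have zq : ('i * t%:C) ^+ 2 = (- t ^+ 2)%:C :> R[i].
  by rewrite exprMn sqr_i -rmorphXn rmorphN mulN1r.
have zE : ccvg (fun N => \sum_(0 <= n < N) ('i * t%:C * X%:C) ^+ n / n`!%:R) (cos (t * X) +i* sin (t * X)).
  by rewrite -mulrA -rmorphM; exact: ccvg_expi_series.
have {}h := ccvgMr (expR (- (t ^+ 2 * v / 2)))%:C (h zq zE).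
rewrite pairing_tscale pairingE -/X -rmorphM cexpi.
rewrite -[_ +i* _]mul1r -[1](rmorph1 (real_complex R)) -(expRxMexpNx_1 (t ^+ 2 * v / 2)).
move: h; rewrite rmorphM.
have -> : - (- t ^+ 2 * v / 2) = t ^+ 2 * v / 2 by ring.
have -> : (expR (- (t ^+ 2 * v / 2)))%:C * ((cos (t * X) +i* sin (t * X)) * (expR (t ^+ 2 * v / 2))%:C) =
  (expR (t ^+ 2 * v / 2))%:C * (expR (- (t ^+ 2 * v / 2)))%:C * (cos (t * X) +i* sin (t * X)).
  by ring.
congr (ccvg _ _); apply/funext => N; rewrite mulr_sumr; apply: eq_bigr => n _.
rewrite wick_hermite// /exp_coef rmorphM rmorph_nat -/v -/X.
by field; rewrite pnatr_eq0 -lt0n fact_gt0.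
Qed.

Lemma wick_series_square F x :
  ccvg (fun N => \sum_(0 <= n < N) square_coef (sqnorm F) n * tpair (W x n) (@tpow R d F n))
    (pairing x F ^+ 2).
Proof.
set v := sqnorm F; set X := re_pairing F x.
suff E N : \sum_(0 <= n < N + 3) square_coef v n * tpair (W x n) (@tpow R d F n) = pairing x F ^+ 2.
  rewrite /ccvg -(cvg_shiftn 3); under eq_fun do rewrite E subrr normc0; exact: cvg_cst.
rewrite addnC (big_cat_nat (n := 3))//= [X in _ + X]big_nat_cond [X in _ + X]big1 ?addr0; last first.
  by move=> n; rewrite andbT => /andP[n3 _]; rewrite /square_coef !gtn_eqF ?mul0r//; lia.
rewrite !big_nat_recr//= big_nil /square_coef/= !wick_hermite// -/v -/X pairingE -/X.
rewrite /hermite_coef /gauss_coef /index_iota/= !big_cons !big_nil/=.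
have C (a b : R) (e : R) : a + b = e -> a%:C + b%:C = e%:C by move=> <-; rewrite rmorphD.
rewrite add0r mul0r addr0 mul1r -!rmorphM -rmorphXn; apply: C.
by rewrite /= !factS fact0 /=; field.
Qed.

Lemma finite_test_exp F t : finite_test gauss W (fun x => cexp ('i * pairing x (tscale t F))).
Proof.
apply: (@finite_test_series F (exp_coef (sqnorm F) t) 1 `|t|) => // [n|x].
  by apply: exp_coef_le; exact: sqnorm_ge0.
exact: wick_series_exp.
Qed.

Lemma finite_test_square F : finite_test gauss W (fun x => pairing x F ^+ 2).
Proof.
have v0 := sqnorm_ge0 F.
apply: (@finite_test_series F (square_coef (sqnorm F)) (sqnorm F + 2) 1) => // [|n|x].
- by rewrite addr_ge0.
- rewrite expr1n mulr1 /square_coef; case: eqP => [->|_].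
    by rewrite normcR ger0_norm// fact0; lra.
  case: eqP => [->|_]; first by rewrite normc1 mul1r lerDr.
  by rewrite normc0 mul0r addr_ge0.
exact: wick_series_square.
Qed.

Lemma finite_test0 : finite_test gauss W (fun=> 0).
Proof.
have f := finite_test_square (fun=> hzero R, fun=> hzero R).
have := finite_test_comb (-1) f f; congr (finite_test _ _ _).
by apply/funext => x; rewrite mulN1r addNr.
Qed.

(** The coefficients of the difference between [<x, F>^2] and its approximation by
    the second difference quotient of [s |-> - exp (i s <x, F>)] at [0]. *)
Definition quotient_coef (v t : R) n : R[i] :=
  (- t ^- 2)%:C * exp_coef v t n + ((- t ^- 2)%:C * exp_coef v (- t) n +
   (2 * t ^- 2)%:C * exp_coef v 0 n) - square_coef v n.

Definition quotient_bound (v : R) : R := 2 + v + v ^+ 2 * expR v.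

(** The orders [0] and [2] agree up to [O(t^2)] by Taylor expansion of
    [exp (- t^2 v / 2)], the odd orders vanish by symmetry, and from the order [4]
    on [t^n / t^2] is at most [t^2].  The coefficient is thus [O(t^2) / n!]
    uniformly in [n], which is what convergence of test functions asks for. *)
Lemma quotient_coef_le (v t : R) n : 0 <= v -> 0 < t -> t <= 1 ->
  normc (quotient_coef v t n) * n`!%:R <= t ^+ 2 * quotient_bound v * 1 ^+ n.
Proof.
move=> v0 t0 t1; rewrite expr1n mulr1.
have tn0 : t != 0 by rewrite gt_eqF.
have t2 : 0 < t ^+ 2 by rewrite exprn_gt0.
have t21 : t ^+ 2 <= 1 by rewrite expr_le1// ltW.
set e := expR (- (t ^+ 2 * v / 2)).
have e0 : 0 <= e by exact: expR_ge0.
have u0 : 0 <= t ^+ 2 * v / 2 by rewrite divr_ge0// mulr_ge0// ltW.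
have e1 : e <= 1 by rewrite -[leRHS]expR0 ler_expR oppr_le0.
have eu : 1 - t ^+ 2 * v / 2 <= e by exact: expR_ge1Dx.
have ev := expR_ge0 v.
have P : 0 <= v ^+ 2 * expR v by rewrite mulr_ge0// sqr_ge0.
have qE : quotient_coef v t n =
  (- t ^- 2 * e)%:C * ('i ^+ n / n`!%:R) * ((t ^+ n + (- t) ^+ n)%:C) + ((2 * t ^- 2)%:C * exp_coef v 0 n) - square_coef v n.
  rewrite /quotient_coef /exp_coef sqrrN -/e !exprMn -!rmorphXn !rmorphM !rmorphD/=.
  ring.
have z0 : (0 : R)%:C = 0 by [].
have exp0 : (0 < n)%N -> exp_coef v 0 n = 0.
  by case: n {qE} => // n _; rewrite /exp_coef z0 mulr0 !expr0n/= !mul0r mulr0.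
case: n qE exp0 => [|[|[|[|n]]]] qE exp0.
- have -> : quotient_coef v t 0 = (- 2 * t ^- 2 * (e - 1) - v)%:C.
    have e00 : exp_coef v 0 0 = 1.
      by rewrite /exp_coef expr0n/= !mul0r oppr0 expR0 expr0 fact0 divr1 mulr1.
    rewrite qE e00 /square_coef/= !expr0 fact0 divr1 !mulr1 -rmorphM -rmorphD -rmorphB /=.
    by congr (_%:C); ring.
  rewrite normcR fact0 mulr1.
  have -> : - 2 * t ^- 2 * (e - 1) - v = - 2 * t ^- 2 * (e - 1 - - (t ^+ 2 * v / 2)) by field.
  rewrite normrM.
  have -> : `|- 2 * t ^- 2| = 2 * t ^- 2 by rewrite mulNr normrN ger0_norm// mulr_ge0// invr_ge0 ltW.
  have b := expR_bound2 (- (t ^+ 2 * v / 2)).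
  have b2 : expR `|- (t ^+ 2 * v / 2)| <= expR v.
    by rewrite ler_expR normrN ger0_norm//; nra.
  have b3 : `|e - 1 - - (t ^+ 2 * v / 2)| <= (t ^+ 2 * v / 2) ^+ 2 * expR v.
    by rewrite (le_trans b)// sqrrN ler_wpM2l// sqr_ge0.
  apply: (@le_trans _ _ (2 * t ^- 2 * ((t ^+ 2 * v / 2) ^+ 2 * expR v))).
    by rewrite ler_wpM2l// mulr_ge0// invr_ge0 ltW.
  have -> : 2 * t ^- 2 * ((t ^+ 2 * v / 2) ^+ 2 * expR v) = t ^+ 2 * (v ^+ 2 * expR v / 2) by field.
  by rewrite ler_wpM2l ?(ltW t2)// /quotient_bound; lra.
- have t3 : t ^+ 1 + (- t) ^+ 1 = 0 by rewrite !expr1 subrr.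
  have -> : quotient_coef v t 1 = 0.
    by rewrite qE exp0// t3 z0 !mulr0 addr0; exact: (subr0 0).
  rewrite normc0 mul0r.
  by rewrite mulr_ge0 ?(ltW t2)// /quotient_bound; lra.
- have -> : quotient_coef v t 2 = (e - 1)%:C.
    have i2 : 'i ^+ 2 / 2`!%:R = (- 2^-1)%:C :> R[i].
      by rewrite sqr_i mulN1r rmorphN fmorphV rmorph_nat.
    rewrite qE exp0// i2 mulr0 addr0 -!rmorphM -[square_coef v 2]/((1 : R)%:C) -rmorphB.
    by congr (_%:C); rewrite sqrrN; field.
  rewrite normcR ler0_norm; last by lra.
  have -> : (2`!)%:R = 2 :> R by [].
  by rewrite /quotient_bound; nra.
- have t3 : t ^+ 3 + (- t) ^+ 3 = 0 by ring.
  have -> : quotient_coef v t 3 = 0.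
    by rewrite qE exp0// t3 z0 !mulr0 addr0; exact: (subr0 0).
  rewrite normc0 mul0r.
  by rewrite mulr_ge0 ?(ltW t2)// /quotient_bound; lra.
have -> : quotient_coef v t n.+4 =
    (- t ^- 2 * e)%:C * ('i ^+ n.+4 / (n.+4)`!%:R) * (t ^+ n.+4 + (- t) ^+ n.+4)%:C.
  by rewrite qE exp0// mulr0 addr0; exact: subr0.
rewrite normcM normcM [normc ('i ^+ _ / _)]normcM normc_natV normcX normc_i expr1n !normcR.
set m := n.+4.
have m0 := fact_neq0 m.
have tm : `|t ^+ m + (- t) ^+ m| <= 2 * t ^+ 4.
  have h : t ^+ m <= t ^+ 4 by apply: ler_wiXn2l => //; exact: ltW.
  rewrite (le_trans (ler_normD _ _))// !normrX normrN (gtr0_norm t0); lra.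
have -> : `|- t ^- 2 * e| = t ^- 2 * e by rewrite mulNr normrN ger0_norm// mulr_ge0// invr_ge0 ltW.
have -> : t ^- 2 * e * (1 / m`!%:R) * `|t ^+ m + (- t) ^+ m| * m`!%:R =
  t ^- 2 * e * `|t ^+ m + (- t) ^+ m| by field; rewrite tn0 m0.
apply: (@le_trans _ _ (t ^- 2 * e * (2 * t ^+ 4))).
  by rewrite ler_wpM2l// mulr_ge0// invr_ge0 ltW.
have -> : t ^- 2 * e * (2 * t ^+ 4) = t ^+ 2 * (2 * e) by field.
by rewrite ler_wpM2l ?(ltW t2)// /quotient_bound; lra.
Qed.

End TestFunctions.

(** * The propagators *)

Section Propagators.
Variables (R : realType) (d : nat) (gauss : probability (dualMs R d) R).
Variable (W : dualM R d -> forall n, tensor R d n).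
Arguments W : clear implicits.
Variable Phi : (dualM R d -> R[i]) -> R[i].
Hypotheses (gaussP : standard_gaussian gauss) (WP : wick_monomials W).
Hypothesis PhiP : hida_distribution gauss W Phi.
Hypothesis PhiT : forall F : testM R d,
  T_transform Phi F = cexp (- 'i * \sum_(mu < d) mtr (mprod (F.1 mu) (F.2 mu))).
Implicit Types (F G : testM R d).

Lemma Phi_comb (a : R[i]) f g : finite_test gauss W f -> finite_test gauss W g ->
  Phi (fun x => a * f x + g x) = a * Phi f + Phi g.
Proof.
by move=> tf tg; apply: PhiP.1; apply: finite_test_hida.
Qed.

Lemma Phi0 : Phi (fun=> 0) = 0.
Proof.
have t0 := finite_test0 gaussP WP.
rewrite -[RHS](addNr (Phi (fun=> 0))) -mulN1r -(Phi_comb (-1) t0 t0).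
by congr Phi; apply/funext => x; rewrite mulr0 addr0.
Qed.

Lemma PhiZ (a : R[i]) f : finite_test gauss W f -> Phi (fun x => a * f x) = a * Phi f.
Proof.
move=> tf; have := Phi_comb a tf (finite_test0 gaussP WP).
by rewrite Phi0 addr0 => <-; congr Phi; apply/funext => x; rewrite addr0.
Qed.

Lemma finite_testZ (a : R[i]) f : finite_test gauss W f -> finite_test gauss W (fun x => a * f x).
Proof.
move=> tf; have := finite_test_comb a tf (finite_test0 gaussP WP).
by congr (finite_test _ _ _); apply/funext => x; rewrite addr0.
Qed.

Lemma Phi_exp F t : Phi (fun x => cexp ('i * pairing x (tscale t F))) =
  cexp (- 'i * (t ^+ 2 * complex.Re (tform F F))%:C).
Proof.
have := PhiT (tscale t F); rewrite tformE /T_transform => ->; congr cexp; congr (_ * _).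
rewrite tform_tcombl !tform_tcombr !mul0r !addr0 tform_real -!rmorphM.
by congr (_%:C); ring.
Qed.

(** Minus the second difference quotient at [0] of [s |-> exp (i s <x, F>)], which
    tends to [<x, F>^2]. *)
Definition second_quotient F t x : R[i] :=
  (- t ^- 2)%:C * cexp ('i * pairing x (tscale t F)) +
  ((- t ^- 2)%:C * cexp ('i * pairing x (tscale (- t) F)) +
   (2 * t ^- 2)%:C * cexp ('i * pairing x (tscale 0 F))).

Lemma finite_test_second_quotient F t : finite_test gauss W (second_quotient F t).
Proof.
apply: finite_test_comb; first exact: finite_test_exp.
apply: finite_test_comb; first exact: finite_test_exp.
by apply: finite_testZ; exact: finite_test_exp.
Qed.

Lemma Phi_second_quotient F t (theta := complex.Re (tform F F)) :
  Phi (second_quotient F t) =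
  (- 2 * t ^- 2 * (cos (t ^+ 2 * theta) - 1)) +i* (2 * t ^- 2 * sin (t ^+ 2 * theta)).
Proof.
have te s := finite_test_exp gaussP WP F s.
rewrite /second_quotient Phi_comb//; last first.
  by apply: finite_test_comb => //; exact: finite_testZ.
rewrite Phi_comb//; last exact: finite_testZ.
rewrite PhiZ// !Phi_exp -/theta.
have E (y : R) : cexp (- 'i * y%:C) = cos y -i* sin y.
  by rewrite mulNr -mulrN -rmorphN cexpi cosN sinN.
rewrite !E sqrrN expr0n/= mul0r cos0 sin0; simpc.
by apply/eqP; rewrite eq_complex/=; apply/andP; split; apply/eqP; ring.
Qed.

(** [Phi] turns the quotient into that of [s |-> exp (- i s^2 theta)]. *)
Lemma Phi_second_quotient_near F t (theta := complex.Re (tform F F)) : 0 < t -> t <= 1 ->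
  normc (Phi (second_quotient F t) - (0 +i* (2 * theta))) <=
  t * (2 * (theta ^+ 2 + `|theta| ^+ 3)).
Proof.
move=> t0 t1; rewrite Phi_second_quotient -/theta.
have tn0 : t != 0 by rewrite gt_eqF.
set y := t ^+ 2 * theta.
apply: (le_trans (normc_le_ReIm _)).
have -> : complex.Re ((- 2 * t ^- 2 * (cos y - 1)) +i* (2 * t ^- 2 * sin y) - (0 +i* (2 * theta))) =
  - (2 * t ^- 2) * (cos y - 1) by rewrite /=; ring.
have -> : complex.Im ((- 2 * t ^- 2 * (cos y - 1)) +i* (2 * t ^- 2 * sin y) - (0 +i* (2 * theta))) =
  2 * t ^- 2 * (sin y - y) by rewrite /= /y; field.
have k0 : 0 <= 2 * t ^- 2 by rewrite mulr_ge0// invr_ge0 exprn_ge0// ltW.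
rewrite [X in X + _ <= _]normrM [X in _ + X <= _]normrM normrN (ger0_norm k0) -mulrDr.
have b1 := cos_bound y; have b2 := sin_bound3 y.
apply: (@le_trans _ _ (2 * t ^- 2 * (y ^+ 2 + `|y| ^+ 3))).
  by rewrite ler_wpM2l// lerD.
have -> : `|y| = t ^+ 2 * `|theta| by rewrite /y normrM normrX (gtr0_norm t0).
have -> : 2 * t ^- 2 * (y ^+ 2 + (t ^+ 2 * `|theta|) ^+ 3) =
  2 * (t * (t * theta ^+ 2) + t * (t ^+ 3 * `|theta| ^+ 3)).
  by rewrite /y; field.
have t30 : 0 <= t ^+ 3 by rewrite exprn_ge0// ltW.
have t31 : t ^+ 3 <= 1 by rewrite exprn_ile1// ltW.
have s0 : 0 <= theta ^+ 2 by exact: sqr_ge0.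
have s1 : 0 <= `|theta| ^+ 3 by exact: exprn_ge0.
rewrite [leRHS]mulrCA ler_wpM2l// mulrDr.
by apply: lerD; rewrite ler_wpM2l ?(ltW t0)// ler_piMl.
Qed.

Lemma small_parameter (A B e e' : R) : 0 <= A -> 0 <= B -> 0 < e -> 0 < e' ->
  exists t, [/\ 0 < t, t <= 1, t * A < e & t * B < e'].
Proof.
move=> A0 B0 e0 e'0.
have A1 : 0 < A + 1 by lra.
have B1 : 0 < B + 1 by lra.
pose t := Num.min 1 (Num.min (e / (A + 1)) (e' / (B + 1))).
have t0 : 0 < t by rewrite !lt_min ltr01 !divr_gt0.
have tA : t * (A + 1) <= e by rewrite -ler_pdivlMr// /t !ge_min lexx orbT.
have tB : t * (B + 1) <= e' by rewrite -ler_pdivlMr// /t !ge_min lexx !orbT.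
exists t; split => //; first by rewrite /t ge_min lexx.
  by nra.
by nra.
Qed.

(** Convergence to [<., F>^2] in each norm of the space of test functions; the
    factor [t] comes from the size [O(t^2)] of the coefficients of the
    difference. *)
Lemma hida_sqnorm_second_quotient F p q : weight p ->
  exists A, 0 <= A /\ forall t, 0 < t -> t <= 1 ->
    (hida_sqnorm gauss W p q (fun x => second_quotient F t x - pairing x F ^+ 2)%R <=
     ((t * A) ^+ 2)%:E)%E.
Proof.
move=> wp; have [M FM] := entry_esum_finite F (fun k l => weight_ge0 k l wp).
set v := sqnorm F; have v0 : 0 <= v by exact: sqnorm_ge0.
have b0 : 0 <= quotient_bound v.
  by rewrite /quotient_bound !addr_ge0// mulr_ge0 ?sqr_ge0 ?expR_ge0.
pose E := 1 ^+ 2 * 2 ^+ q * M : R.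
exists (quotient_bound v * expR (E / 2)); split; first by rewrite mulr_ge0// expR_ge0.
move=> t t0 t1.
have cf x : ccvg (fun N => \sum_(0 <= n < N) quotient_coef v t n * tpair (W x n) (@tpow R d F n))
    (second_quotient F t x - pairing x F ^+ 2).
  have e s := wick_series_exp WP F s x.
  have h := ccvgD (ccvgMr (- t ^- 2)%:C (e t)) (ccvgD (ccvgMr (- t ^- 2)%:C (e (- t)))
    (ccvgMr (2 * t ^- 2)%:C (e 0))).
  have := ccvgD h (ccvgMr (-1) (wick_series_square WP F x)); rewrite mulN1r.
  have lin (u1 u2 u3 u4 : nat -> R[i]) a b c N : (a * (\sum_(0 <= n < N) u1 n) +
      (b * (\sum_(0 <= n < N) u2 n) + c * (\sum_(0 <= n < N) u3 n))) +
      (-1) * (\sum_(0 <= n < N) u4 n) =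
      \sum_(0 <= n < N) (a * u1 n + (b * u2 n + c * u3 n) - u4 n).
    elim: N => [|N IH]; first by rewrite !big_nil; ring.
    by rewrite !big_nat_recr//= -IH; ring.
  congr (ccvg _ _); apply/funext => N; rewrite lin; apply: eq_bigr => n _.
  rewrite /quotient_coef -/v.
  move: (tpair _ _) (exp_coef v t n) (exp_coef v (- t) n) (exp_coef v 0 n) (square_coef v n).
  move: (- t ^- 2)%:C (2 * t ^- 2)%:C => a b; move=> *; ring.
have C0 : 0 <= t ^+ 2 * quotient_bound v by rewrite mulr_ge0// sqr_ge0.
apply: le_trans (hida_sqnorm_series gaussP WP C0 ler01 _ cf q wp FM) _.
  by move=> n; exact: quotient_coef_le.
rewrite lee_fin -/E.
have -> : expR E = expR (E / 2) ^+ 2 by rewrite -expRM_natl; congr expR; field.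
rewrite -exprMn ler_pXn2r ?nnegrE ?mulr_ge0 ?expR_ge0 ?(ltW t0)//.
rewrite mulrA ler_wpM2r ?expR_ge0// ler_wpM2r// expr2 ler_piMl// ltW//.
Qed.

(** Continuity of [Phi] at [<., F>^2] allows one to differentiate the [T]-transform
    twice at [0] along [F]. *)
Lemma Phi_square F : Phi (fun x => pairing x F ^+ 2) = 2 * 'i * tform F F.
Proof.
set theta := complex.Re (tform F F).
have -> : 2 * 'i * tform F F = 0 +i* (2 * theta) by rewrite tform_real -/theta; simpc.
apply/eqP; rewrite -subr_eq0; apply/eqP/eq0_normc/eqP; rewrite eq_le normc_ge0 andbT.
apply/ler_addgt0Pr => e e0; rewrite add0r.
have tsq := finite_test_square gaussP WP F.
have e2 : 0 < e / 2 by rewrite divr_gt0.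
have [p [q [dl [wp dl0 cont]]]] := PhiP.2 _ (finite_test_hida tsq) _ e2.
have [A [A0 hA]] := hida_sqnorm_second_quotient F q wp.
have B0 : 0 <= 2 * (theta ^+ 2 + `|theta| ^+ 3).
  by rewrite mulr_ge0// addr_ge0 ?sqr_ge0 ?exprn_ge0.
have [t [t0 t1 tA tB]] := small_parameter A0 B0 dl0 e2.
have tq := finite_test_second_quotient F t.
have c := cont _ (finite_test_hida tq).
have {}c : normc (Phi (second_quotient F t) - Phi (fun x => pairing x F ^+ 2)) < e / 2.
  apply: c; apply: le_lt_trans (hA t t0 t1) _.
  by rewrite lte_fin ltr_pXn2r// nnegrE ?mulr_ge0 ?(ltW t0)// ltW.
have n := Phi_second_quotient_near F t0 t1; rewrite -/theta in n.
have -> : Phi (fun x => pairing x F ^+ 2) - (0 +i* (2 * theta)) =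
  - (Phi (second_quotient F t) - Phi (fun x => pairing x F ^+ 2)) +
  (Phi (second_quotient F t) - (0 +i* (2 * theta))) by ring.
by rewrite (le_trans (le_normcD _ _))// normcN; lra.
Qed.

Lemma polarisation x F G : pairing x F * pairing x G =
  4^-1 * pairing x (tcomb 1 1 F G) ^+ 2 + (- 4^-1) * pairing x (tcomb 1 (-1) F G) ^+ 2.
Proof.
by rewrite !pairing_tcomb rmorphN !rmorph1; field.
Qed.

Lemma finite_test_product F G : finite_test gauss W (fun x => pairing x F * pairing x G).
Proof.
under eq_fun do rewrite polarisation.
apply: finite_test_comb; first exact: finite_test_square.
by apply: finite_testZ; exact: finite_test_square.
Qed.

Lemma Phi_product F G :
  Phi (fun x => pairing x F * pairing x G) = 'i * (tform F G + tform G F).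
Proof.
under eq_fun do rewrite polarisation.
rewrite Phi_comb; [|exact: finite_test_square|by apply: finite_testZ; exact: finite_test_square].
rewrite PhiZ; last exact: finite_test_square.
by rewrite !Phi_square !tform_tcombl !tform_tcombr rmorphN !rmorph1; field.
Qed.

(** Matrix coefficients are complex combinations of two pairings. *)
Lemma Phi_complex_product F F' G G' :
  Phi (fun x => (pairing x F + 'i * pairing x F') * (pairing x G + 'i * pairing x G')) =
  'i * ((tform F G + 'i * tform F G') + 'i * (tform F' G + 'i * tform F' G')) +
  'i * ((tform G F + 'i * tform G' F) + 'i * (tform G F' + 'i * tform G' F')).
Proof.
have E x : (pairing x F + 'i * pairing x F') * (pairing x G + 'i * pairing x G') =
    1 * (pairing x F * pairing x G) + ('i * (pairing x F * pairing x G') +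
    ('i * (pairing x F' * pairing x G) + ('i * 'i) * (pairing x F' * pairing x G'))).
  by ring.
have tp := finite_test_product.
under eq_fun do rewrite E.
have t1 := finite_testZ ('i%R * 'i%R) (tp F' G').
have t2 := finite_test_comb 'i%R (tp F' G) t1.
have t3 := finite_test_comb 'i%R (tp F G') t2.
rewrite (Phi_comb 1 (tp F G) t3) (Phi_comb 'i%R (tp F G') t2) (Phi_comb 'i%R (tp F' G) t1).
rewrite (PhiZ ('i%R * 'i%R) (tp F' G')) !Phi_product; ring.
Qed.

Lemma component_pairing x (s : 'I_d + 'I_d) k l :
  component x s k l =
  pairing x (tsingle s (re_entry R k l)) + 'i * pairing x (tsingle s (im_entry R k l)).
Proof. by rewrite !pairing_tsingle mpair_entry. Qed.

Lemma Phi_component_AB mu nu k l m n :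
  Phi (fun x => component x (inl mu) k l * component x (inr nu) m n) =
  'i * (mu == nu)%:R * (k == n)%:R * (l == m)%:R.
Proof.
under eq_fun do rewrite !component_pairing.
rewrite Phi_complex_product !tform_BX !tform_AB.
have -> : 'i * ((mu == nu)%:R * mpair (re_entry R k l) (re_entry R m n) +
    'i * ((mu == nu)%:R * mpair (re_entry R k l) (im_entry R m n)) +
    'i * ((mu == nu)%:R * mpair (im_entry R k l) (re_entry R m n) +
    'i * ((mu == nu)%:R * mpair (im_entry R k l) (im_entry R m n)))) +
   'i * (0 + 'i * 0 + 'i * (0 + 'i * 0)) =
   'i * (mu == nu)%:R * ((mpair (re_entry R k l) (re_entry R m n) +
    'i * mpair (re_entry R k l) (im_entry R m n)) +
   'i * (mpair (im_entry R k l) (re_entry R m n) +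
    'i * mpair (im_entry R k l) (im_entry R m n))) by ring.
rewrite !mpair_entry re_im_entry /unit_entry -[RHS]mulrA; congr (_ * _).
by rewrite -natrM mulnb andbC ![_ == k]eq_sym ![_ == l]eq_sym.
Qed.

Lemma Phi_component_AA mu nu k l m n :
  Phi (fun x => component x (inl mu) k l * component x (inl nu) m n) = 0.
Proof.
under eq_fun do rewrite !component_pairing.
by rewrite Phi_complex_product !tform_XA !(mulr0, addr0).
Qed.

Lemma Phi_component_BB mu nu k l m n :
  Phi (fun x => component x (inr mu) k l * component x (inr nu) m n) = 0.
Proof.
under eq_fun do rewrite !component_pairing.
by rewrite Phi_complex_product !tform_BX !(mulr0, addr0).
Qed.

End Propagators.

Theorem theorem4p5 (R : realType) (d : nat)
    (gauss : probability (dualMs R d) R) (Wick : dualM R d -> forall n, tensor R d n)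
    (Phi : (dualM R d -> R[i]) -> R[i]) :
  standard_gaussian gauss ->
  wick_monomials Wick ->
  hida_distribution gauss Wick Phi ->
  (forall F : testM R d,
     T_transform Phi F =
     cexp (- 'i * \sum_(mu < d) mtr (mprod (F.1 mu) (F.2 mu)))) ->
  forall (mu nu : 'I_d) (k l m n : nat),
  [/\ propagator Phi (entryA mu k l) (entryB nu m n) =
        'i * (mu == nu)%:R * (k == n)%:R * (l == m)%:R,
      propagator Phi (entryA mu k l) (entryA nu m n) = 0 &
      propagator Phi (entryB mu k l) (entryB nu m n) = 0].
Proof.
move=> gaussP WP PhiP PhiT mu nu k l m n; split.
- exact: (Phi_component_AB gaussP WP PhiP PhiT).
- exact: (Phi_component_AA gaussP WP PhiP PhiT mu nu k l m n).
- exact: (Phi_component_BB gaussP WP PhiP PhiT mu nu k l m n).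
Qed.
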